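(* Let $p$ be a prime number with $p\neq2$, let $R=\mathbb{F}_p[[u,v]]/(uv)$ and $A=R[x,y,(x-y)^{-1}]/(xy-u)$. Then: (1) $A^{p^\infty/R}\simeq\dfrac{R[\alpha]}{(u\alpha,\,v^2-\alpha^2)}$ as $R$-algebras, mapping to $A$ by $\alpha\mapsto v\,\dfrac{x+y}{x-y}$; (2) $(A^{p^\infty/R})^{p^\infty/R}\simeq R$.
   Context: For a ring $R$ of characteristic $p$ with absolute Frobenius $F$ and an $R$-algebra $B$, let $B^{p^i/R}=B\otimes_{R,F^i}R$, with relative Frobenius $R$-algebra maps $B^{p^{i+1}/R}\to B^{p^i/R}$. The preperfection of $B$ is $B^{p^\infty/R}=\lim(\cdots\to B^{p^2/R}\to B^{p/R}\to B)$; it has a canonical map to $B$ (projection to the $0$-th term), which is the map to $A$ meant in (1). *)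

(* Defs.v *)
From HB Require Import structures.
From mathcomp Require Import all_boot all_order all_algebra.
From mathcomp Require Import boolp.
From mathcomp Require Import mpoly.

Set Implicit Arguments.
Unset Strict Implicit.
Unset Printing Implicit Defensive.

Import GRing.Theory.
Local Open Scope ring_scope.
Local Open Scope quotient_scope.

(* An R-algebra is a [comAlgType R], which is nonzero by definition; for such  *)
(* B the twists B^{p^i/R} and the preperfection are nonzero too.              *)

Section FrobeniusTwist.

Variables (p : nat) (R : comNzRingType) (hR : p \in [pchar R]).

Definition frobn (i : nat) (a : R) : R := iter i (pFrobenius_aut hR) a.

Lemma frobnE i a : frobn i a = a ^+ (p ^ i).
Proof.
elim: i => [|i IH] /=; first by rewrite expn0 expr1.
by rewrite pFrobenius_autE -/(frobn i a) IH -exprM expnSr.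
Qed.

Section Tensor.

Variables (i : nat) (B : comAlgType R).

(* The list [:: (b1, r1); ...; (bn, rn)] stands for the sum of the pure       *)
(* tensors bk (x) rk of B (x)_{R, F^i} R. As [(b, r)] and [(- b, r)] add up   *)
(* to [(0, r)], this monoid presentation does define an abelian group.        *)
Inductive tens_eq : seq (B * R) -> seq (B * R) -> Prop :=
| tens_refl s : tens_eq s s
| tens_sym s t : tens_eq s t -> tens_eq t s
| tens_trans s t u : tens_eq s t -> tens_eq t u -> tens_eq s u
| tens_cat s s' t t' : tens_eq s s' -> tens_eq t t' ->
    tens_eq (s ++ t) (s' ++ t')
| tens_catC s t : tens_eq (s ++ t) (t ++ s)
| tens_zero r : tens_eq [:: (0, r)] [::]
| tens_addl b b' r : tens_eq [:: (b + b', r)] [:: (b, r); (b', r)]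
| tens_addr b r r' : tens_eq [:: (b, r + r')] [:: (b, r); (b, r')]
| tens_bal a b r : tens_eq [:: (a *: b, r)] [:: (b, frobn i a * r)].

Definition tens_eqb (s t : seq (B * R)) : bool := `[< tens_eq s t >].

Lemma tens_eqb_equiv : equiv_class_of tens_eqb.
Proof.
split=> [s|s t|t s u].
- exact/asboolP/tens_refl.
- by apply/asboolP/asboolP; exact: tens_sym.
- by move=> /asboolP st /asboolP tu; apply/asboolP; exact: tens_trans tu.
Qed.

Canonical tens_eqb_equiv_rel := EquivRelPack tens_eqb_equiv.
Canonical tens_eqb_enc := defaultEncModRel tens_eqb.

(* B^{p^i/R} = B (x)_{R, F^i} R *)
Definition ftwist := {eq_quot tens_eqb}.

HB.instance Definition _ := Choice.on ftwist.
HB.instance Definition _ : EqQuotient _ tens_eqb ftwist := EqQuotient.on ftwist.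

Lemma ftwist_eqP s t : reflect (tens_eq s t) (\pi_ftwist s == \pi_ftwist t).
Proof. by rewrite piE; exact: asboolP. Qed.

Lemma tens_repr s : tens_eq (repr (\pi_ftwist s)) s.
Proof. by apply/ftwist_eqP; rewrite reprK. Qed.

Lemma ftwistW (P : ftwist -> Prop) :
  (forall s, P (\pi_ftwist s)) -> forall X, P X.
Proof. exact: quotW. Qed.

Definition tens_opp (s : seq (B * R)) := [seq (- x.1, x.2) | x <- s].

Definition ftwist_zero : ftwist := \pi_ftwist [::].
Definition ftwist_add (X Y : ftwist) : ftwist := \pi_ftwist (repr X ++ repr Y).
Definition ftwist_opp (X : ftwist) : ftwist := \pi_ftwist (tens_opp (repr X)).

Lemma ftwist_addE s t :
  ftwist_add (\pi_ftwist s) (\pi_ftwist t) = \pi_ftwist (s ++ t).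
Proof. by apply/eqP/ftwist_eqP/tens_cat; exact: tens_repr. Qed.

Lemma ftwist_addA : associative ftwist_add.
Proof.
move=> X Y Z; elim/ftwistW: X => s; elim/ftwistW: Y => t; elim/ftwistW: Z => u.
by rewrite !ftwist_addE catA.
Qed.

Lemma ftwist_addC : commutative ftwist_add.
Proof.
move=> X Y; elim/ftwistW: X => s; elim/ftwistW: Y => t.
by rewrite !ftwist_addE; apply/eqP/ftwist_eqP/tens_catC.
Qed.

Lemma ftwist_add0 : left_id ftwist_zero ftwist_add.
Proof. by move=> X; elim/ftwistW: X => s; rewrite ftwist_addE. Qed.

Lemma ftwist_addN : left_inverse ftwist_zero ftwist_opp ftwist_add.
Proof.
move=> X; rewrite -{2}[X]reprK /ftwist_opp ftwist_addE.
apply/eqP/ftwist_eqP; elim: (repr X) => [|[b r] s IH] /=; first exact: tens_refl.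
apply: (@tens_trans _ ([:: (- b, r); (b, r)] ++ (tens_opp s ++ s))).
  apply: (@tens_cat [:: (- b, r)] [:: (- b, r)] _ ((b, r) :: tens_opp s ++ s)).
    exact: tens_refl.
  rewrite -cat1s catA -[_ :: _ ++ _]cat1s [X in tens_eq _ X]catA.
  by apply: tens_cat; [exact: tens_catC|exact: tens_refl].
apply: (@tens_cat _ [::] _ [::]) => //.
apply: (@tens_trans _ [:: (- b + b, r)]); first exact/tens_sym/tens_addl.
by rewrite addNr; exact: tens_zero.
Qed.

HB.instance Definition _ := GRing.isZmodule.Build ftwist
  ftwist_addA ftwist_addC ftwist_add0 ftwist_addN.

Lemma ftwist_piD s t : \pi_ftwist (s ++ t) = \pi_ftwist s + \pi_ftwist t.
Proof. by rewrite -ftwist_addE. Qed.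

Definition tens (b : B) (r : R) : ftwist := \pi_ftwist [:: (b, r)].

Lemma ftwist_piE s : \pi_ftwist s = \sum_(x <- s) tens x.1 x.2.
Proof.
elim: s => [|[b r] s IH]; first by rewrite big_nil.
by rewrite big_cons -IH -ftwist_piD.
Qed.

Lemma ftwistE (X : ftwist) : X = \sum_(x <- repr X) tens x.1 x.2.
Proof. by rewrite -ftwist_piE reprK. Qed.

Lemma tensDl b b' r : tens (b + b') r = tens b r + tens b' r.
Proof. by rewrite -ftwist_piD; apply/eqP/ftwist_eqP/tens_addl. Qed.

Lemma tensDr b r r' : tens b (r + r') = tens b r + tens b r'.
Proof. by rewrite -ftwist_piD; apply/eqP/ftwist_eqP/tens_addr. Qed.

Lemma tens_balE a b r : tens (a *: b) r = tens b (frobn i a * r).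
Proof. by apply/eqP/ftwist_eqP/tens_bal. Qed.

Lemma ftwist_ind (P : ftwist -> Prop) :
  P 0 -> (forall X Y, P X -> P Y -> P (X + Y)) -> (forall b r, P (tens b r)) ->
  forall X, P X.
Proof. by move=> P0 PD Pt X; rewrite (ftwistE X); elim/big_ind: _. Qed.

(* Universal property of the tensor product. *)
Section Lift.

Variables (V : zmodType) (f : B -> R -> V).

Definition tens_compatible :=
  [/\ forall b b' r, f (b + b') r = f b r + f b' r,
      forall b r r', f b (r + r') = f b r + f b r' &
      forall a b r, f (a *: b) r = f b (frobn i a * r)].

Definition tens_lift (X : ftwist) : V := \sum_(x <- repr X) f x.1 x.2.

Hypothesis hf : tens_compatible.

Lemma tens_lift_pi s : tens_lift (\pi_ftwist s) = \sum_(x <- s) f x.1 x.2.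
Proof.
have [fDl fDr fb] := hf; rewrite /tens_lift.
have := tens_repr s; move: (repr _) => s'; elim=> {s s'} //.
- by move=> t u v _ -> _ ->.
- by move=> t t' u u' _ e _ e'; rewrite !big_cat /= e e'.
- by move=> t u; rewrite !big_cat /= addrC.
- move=> r; rewrite big_seq1 big_nil /=.
  by apply: (addrI (f 0 r)); rewrite -fDl !addr0.
- by move=> b b' r; rewrite !big_cons big_nil !addr0 /= fDl.
- by move=> b r r'; rewrite !big_cons big_nil !addr0 /= fDr.
- by move=> a b r; rewrite !big_seq1 /= fb.
Qed.

Lemma tens_liftE b r : tens_lift (tens b r) = f b r.
Proof. by rewrite tens_lift_pi big_seq1. Qed.

Lemma tens_liftD X Y : tens_lift (X + Y) = tens_lift X + tens_lift Y.
Proof.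
elim/ftwistW: X => s; elim/ftwistW: Y => t.
by rewrite -ftwist_piD !tens_lift_pi big_cat.
Qed.

Lemma tens_lift0 : tens_lift 0 = 0.
Proof. by apply: (addrI (tens_lift 0)); rewrite -tens_liftD !addr0. Qed.

End Lift.

Lemma frobnM a b : frobn i (a * b) = frobn i a * frobn i b.
Proof. by rewrite !frobnE exprMn. Qed.

Definition mul_tens (Y : ftwist) (b : B) (r : R) : ftwist :=
  tens_lift (fun b' r' => tens (b * b') (r * r')) Y.

Definition ftwist_mul (X Y : ftwist) : ftwist := tens_lift (mul_tens Y) X.

Lemma mul_tens_inner b r : tens_compatible (fun b' r' => tens (b * b') (r * r')).
Proof.
split=> [b1 b2 s|b1 s1 s2|a b1 s]; first by rewrite mulrDr tensDl.
  by rewrite mulrDr tensDr.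
by rewrite -scalerAr tens_balE mulrCA.
Qed.

Lemma mul_tensE b r b' r' : mul_tens (tens b' r') b r = tens (b * b') (r * r').
Proof. exact/tens_liftE/mul_tens_inner. Qed.

Lemma mul_tensD Y Z b r : mul_tens (Y + Z) b r = mul_tens Y b r + mul_tens Z b r.
Proof. exact/tens_liftD/mul_tens_inner. Qed.

Lemma mul_tens0 b r : mul_tens 0 b r = 0.
Proof. exact/tens_lift0/mul_tens_inner. Qed.

Lemma mul_tens_outer Y : tens_compatible (mul_tens Y).
Proof.
split=> [b b' r|b r r'|a b r]; elim/ftwist_ind: Y.
- by rewrite !mul_tens0 addr0.
- by move=> X Y eX eY; rewrite !mul_tensD eX eY addrACA.
- by move=> c s; rewrite !mul_tensE mulrDl tensDl.
- by rewrite !mul_tens0 addr0.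
- by move=> X Y eX eY; rewrite !mul_tensD eX eY addrACA.
- by move=> c s; rewrite !mul_tensE mulrDl tensDr.
- by rewrite !mul_tens0.
- by move=> X Y eX eY; rewrite !mul_tensD eX eY.
- by move=> c s; rewrite !mul_tensE -scalerAl tens_balE mulrA.
Qed.

Lemma ftwist_mulDl : left_distributive ftwist_mul +%R.
Proof. by move=> X Y Z; exact/tens_liftD/mul_tens_outer. Qed.

Lemma ftwist_mul0l Y : ftwist_mul 0 Y = 0.
Proof. exact/tens_lift0/mul_tens_outer. Qed.

Lemma ftwist_mulE b r b' r' :
  ftwist_mul (tens b r) (tens b' r') = tens (b * b') (r * r').
Proof. by rewrite /ftwist_mul tens_liftE ?mul_tensE //; exact: mul_tens_outer. Qed.

Lemma ftwist_mulDr : right_distributive ftwist_mul +%R.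
Proof.
move=> X Y Z; elim/ftwist_ind: X => [|X X' e e'|b r].
- by rewrite !ftwist_mul0l addr0.
- by rewrite !ftwist_mulDl e e' addrACA.
- by rewrite /ftwist_mul !tens_liftE ?mul_tensD //; exact: mul_tens_outer.
Qed.

Lemma ftwist_mul0r X : ftwist_mul X 0 = 0.
Proof. by apply: (addrI (ftwist_mul X 0)); rewrite -ftwist_mulDr !addr0. Qed.

Lemma ftwist_mulC : commutative ftwist_mul.
Proof.
move=> X Y; elim/ftwist_ind: X => [|X X' e e'|b r].
- by rewrite ftwist_mul0l ftwist_mul0r.
- by rewrite ftwist_mulDl ftwist_mulDr e e'.
elim/ftwist_ind: Y => [|Y Y' e e'|b' r'].
- by rewrite ftwist_mul0l ftwist_mul0r.
- by rewrite ftwist_mulDl ftwist_mulDr e e'.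
by rewrite !ftwist_mulE mulrC [r * _]mulrC.
Qed.

Lemma ftwist_mulA : associative ftwist_mul.
Proof.
move=> X Y Z; elim/ftwist_ind: X => [|X X' e e'|b r].
- by rewrite !ftwist_mul0l.
- by rewrite !ftwist_mulDl e e'.
elim/ftwist_ind: Y => [|Y Y' e e'|b' r'].
- by rewrite !(ftwist_mul0l, ftwist_mul0r).
- by rewrite !(ftwist_mulDl, ftwist_mulDr) e e'.
elim/ftwist_ind: Z => [|Z Z' e e'|b'' r''].
- by rewrite !ftwist_mul0r.
- by rewrite !ftwist_mulDr e e'.
by rewrite !ftwist_mulE !mulrA.
Qed.

Lemma ftwist_mul1 : left_id (tens 1 1) ftwist_mul.
Proof.
move=> X; elim/ftwist_ind: X => [|X X' e e'|b r].
- by rewrite ftwist_mul0r.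
- by rewrite ftwist_mulDr e e'.
by rewrite ftwist_mulE !mul1r.
Qed.

Lemma pchar_alg : p \in [pchar B].
Proof. exact: (rmorph_pchar (in_alg B)) hR. Qed.

Lemma exprDp j (b b' : B) : (b + b') ^+ (p ^ j) = b ^+ (p ^ j) + b' ^+ (p ^ j).
Proof.
elim: j => [|j IH]; first by rewrite expn0 !expr1.
rewrite expnSr !exprM IH -(pFrobenius_autE pchar_alg).
exact: pFrobenius_autD_comm (mulrC _ _).
Qed.

Lemma aug_compatible : tens_compatible (fun b r => r *: b ^+ (p ^ i)).
Proof.
split=> [b b' r|b r r'|a b r]; first by rewrite exprDp scalerDr.
  by rewrite scalerDl.
by rewrite exprZn scalerA frobnE mulrC.
Qed.

(* 1 != 0 because B is nonzero and b (x) r |-> r b^(p^i) maps 1 to 1. *)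
Lemma ftwist_1neq0 : tens 1 1 != 0.
Proof.
apply/eqP=> /(congr1 (tens_lift (fun b r => r *: b ^+ (p ^ i)))).
rewrite tens_liftE ?tens_lift0; try exact: aug_compatible.
by rewrite expr1n scale1r => /eqP; rewrite oner_eq0.
Qed.

HB.instance Definition _ := GRing.Zmodule_isComNzRing.Build ftwist
  ftwist_mulA ftwist_mulC ftwist_mul1 ftwist_mulDl ftwist_1neq0.

Lemma tensM b r b' r' : tens b r * tens b' r' = tens (b * b') (r * r').
Proof. exact: ftwist_mulE. Qed.

Lemma tens11 : tens 1 1 = 1. Proof. by []. Qed.

Definition ftwist_scale (a : R) (X : ftwist) : ftwist := tens 1 a * X.

Lemma ftwist_scaleA a b X :
  ftwist_scale a (ftwist_scale b X) = ftwist_scale (a * b) X.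
Proof. by rewrite /ftwist_scale mulrA tensM mul1r. Qed.

Lemma ftwist_scale1 : left_id 1 ftwist_scale.
Proof. by move=> X; rewrite /ftwist_scale tens11 mul1r. Qed.

Lemma ftwist_scaleDr : right_distributive ftwist_scale +%R.
Proof. by move=> a X Y; exact: mulrDr. Qed.

Lemma ftwist_scaleDl X : {morph ftwist_scale^~ X : a b / a + b}.
Proof. by move=> a b; rewrite /ftwist_scale tensDr mulrDl. Qed.

HB.instance Definition _ := GRing.Zmodule_isLmodule.Build R ftwist
  ftwist_scaleA ftwist_scale1 ftwist_scaleDr ftwist_scaleDl.

Lemma ftwist_scaleAl (a : R) (X Y : ftwist) : a *: (X * Y) = (a *: X) * Y.
Proof. exact: mulrA. Qed.

HB.instance Definition _ := GRing.Lmodule_isLalgebra.Build R ftwist ftwist_scaleAl.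
HB.instance Definition _ := GRing.Lalgebra_isComAlgebra.Build R ftwist.

Lemma tensZ a b r : a *: tens b r = tens b (a * r).
Proof. by rewrite [LHS]tensM mul1r. Qed.

Section LiftAlg.

Variables (S : comAlgType R) (f : B -> R -> S).
Hypotheses (hf : tens_compatible f) (f1 : f 1 1 = 1).
Hypothesis fM : forall b r b' r', f (b * b') (r * r') = f b r * f b' r'.
Hypothesis fZ : forall a b r, f b (a * r) = a *: f b r.

Lemma tens_lift_is_zmod : zmod_morphism (tens_lift f).
Proof.
move=> X Y; apply: (addIr (tens_lift f Y)).
by rewrite -tens_liftD // !subrK.
Qed.

Lemma tens_lift_is_monoid : monoid_morphism (tens_lift f).
Proof.
split=> [|X Y]; first by rewrite -tens11 tens_liftE.
elim/ftwist_ind: X => [|X X' e e'|b r].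
- by rewrite mul0r tens_lift0 // mul0r.
- by rewrite mulrDl !tens_liftD // e e' mulrDl.
elim/ftwist_ind: Y => [|Y Y' e e'|b' r'].
- by rewrite mulr0 tens_lift0 // mulr0.
- by rewrite mulrDr !tens_liftD // e e' mulrDr.
by rewrite tensM !tens_liftE.
Qed.

Lemma tens_lift_is_scalable : scalable (tens_lift f).
Proof.
move=> a X; elim/ftwist_ind: X => [|X X' e e'|b r].
- by rewrite scaler0 tens_lift0 // scaler0.
- by rewrite scalerDr !tens_liftD // e e' scalerDr.
by rewrite tensZ !tens_liftE.
Qed.

End LiftAlg.

End Tensor.

Section RelativeFrobenius.

Variables (i : nat) (B : comAlgType R).

Definition relfrob_fun (b : B) (r : R) : ftwist i B := tens i (b ^+ p) r.

(* b (x) r |-> b^p (x) r, from B^{p^{i+1}/R} to B^{p^i/R} *)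
Definition relfrob : ftwist i.+1 B -> ftwist i B := tens_lift relfrob_fun.

Lemma relfrob_compatible : tens_compatible i.+1 relfrob_fun.
Proof.
split=> [b b' r|b r r'|a b r]; rewrite /relfrob_fun.
- by have := exprDp 1 b b'; rewrite expn1 => ->; rewrite tensDl.
- by rewrite tensDr.
- by rewrite exprZn tens_balE !frobnE -exprM -expnS.
Qed.

Lemma relfrobE b r : relfrob (tens i.+1 b r) = tens i (b ^+ p) r.
Proof. exact/tens_liftE/relfrob_compatible. Qed.

Fact relfrob_is_zmod : zmod_morphism relfrob.
Proof. exact/tens_lift_is_zmod/relfrob_compatible. Qed.

Fact relfrob_is_monoid : monoid_morphism relfrob.
Proof.
apply: tens_lift_is_monoid; first exact: relfrob_compatible.
  by rewrite /relfrob_fun expr1n.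
by move=> b r b' r'; rewrite /relfrob_fun exprMn tensM.
Qed.

Fact relfrob_is_scalable : scalable relfrob.
Proof.
apply: tens_lift_is_scalable; first exact: relfrob_compatible.
by move=> a b r; rewrite /relfrob_fun tensZ.
Qed.

HB.instance Definition _ :=
  GRing.isZmodMorphism.Build (ftwist i.+1 B) (ftwist i B) relfrob relfrob_is_zmod.
HB.instance Definition _ :=
  GRing.isMonoidMorphism.Build (ftwist i.+1 B) (ftwist i B) relfrob relfrob_is_monoid.
HB.instance Definition _ :=
  GRing.isScalable.Build R (ftwist i.+1 B) (ftwist i B) *:%R relfrob relfrob_is_scalable.

End RelativeFrobenius.

Section Preperfection.

Variable B : comAlgType R.

(* B^{p^0/R} = B (x)_R R is identified with B by b (x) r |-> r b. *)
Definition ftwist0_to : ftwist 0 B -> B := tens_lift (fun b r => r *: b).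

Lemma ftwist0_compatible : tens_compatible 0 (fun (b : B) r => r *: b).
Proof.
split=> [b b' r|b r r'|a b r]; first by rewrite scalerDr.
  by rewrite scalerDl.
by rewrite scalerA mulrC.
Qed.

Lemma ftwist0_toE b r : ftwist0_to (tens 0 b r) = r *: b.
Proof. exact/tens_liftE/ftwist0_compatible. Qed.

Fact ftwist0_to_is_zmod : zmod_morphism ftwist0_to.
Proof. exact/tens_lift_is_zmod/ftwist0_compatible. Qed.

Fact ftwist0_to_is_monoid : monoid_morphism ftwist0_to.
Proof.
apply: tens_lift_is_monoid; first exact: ftwist0_compatible.
  by rewrite scale1r.
by move=> b r b' r'; rewrite -scalerAl -scalerAr scalerA.
Qed.

Fact ftwist0_to_is_scalable : scalable ftwist0_to.
Proof.
apply: tens_lift_is_scalable; first exact: ftwist0_compatible.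
by move=> a b r; rewrite scalerA.
Qed.

HB.instance Definition _ :=
  GRing.isZmodMorphism.Build (ftwist 0 B) B ftwist0_to ftwist0_to_is_zmod.
HB.instance Definition _ :=
  GRing.isMonoidMorphism.Build (ftwist 0 B) B ftwist0_to ftwist0_to_is_monoid.
HB.instance Definition _ :=
  GRing.isScalable.Build R (ftwist 0 B) B *:%R ftwist0_to ftwist0_to_is_scalable.

(* B^{p^oo/R} = lim (... -> B^{p^2/R} -> B^{p/R} -> B) *)
Record preperf := Preperf {
  pp_val :> forall i, ftwist i B;
  pp_valP : forall i, relfrob (pp_val i.+1) = pp_val i }.

HB.instance Definition _ := gen_eqMixin preperf.
HB.instance Definition _ := gen_choiceMixin preperf.

Lemma preperf_eq (x y : preperf) : (forall i, x i = y i) -> x = y.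
Proof.
case: x y => [x hx] [y hy] /= e.
have {}e : x = y by exact: functional_extensionality_dep.
by case: _ / e hy => hy; rewrite (Prop_irrelevance hx hy).
Qed.

Definition pp_zero : preperf :=
  @Preperf (fun=> 0) (fun i => rmorph0 (@relfrob i B)).

Definition pp_one : preperf :=
  @Preperf (fun=> 1) (fun i => rmorph1 (@relfrob i B)).

Fact pp_oppP (x : preperf) i : relfrob (- x i.+1) = - x i.
Proof. by rewrite rmorphN /= pp_valP. Qed.
Definition pp_opp (x : preperf) : preperf := Preperf (pp_oppP x).

Fact pp_addP (x y : preperf) i : relfrob (x i.+1 + y i.+1) = x i + y i.
Proof. by rewrite rmorphD /= !pp_valP. Qed.
Definition pp_add (x y : preperf) : preperf := Preperf (pp_addP x y).

Fact pp_mulP (x y : preperf) i : relfrob (x i.+1 * y i.+1) = x i * y i.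
Proof. by rewrite rmorphM /= !pp_valP. Qed.
Definition pp_mul (x y : preperf) : preperf := Preperf (pp_mulP x y).

Fact pp_scaleP (a : R) (x : preperf) i : relfrob (a *: x i.+1) = a *: x i.
Proof. by rewrite linearZ /= pp_valP. Qed.
Definition pp_scale (a : R) (x : preperf) : preperf := Preperf (pp_scaleP a x).

Fact pp_addA : associative pp_add.
Proof. by move=> x y z; apply: preperf_eq => i /=; rewrite addrA. Qed.
Fact pp_addC : commutative pp_add.
Proof. by move=> x y; apply: preperf_eq => i /=; rewrite addrC. Qed.
Fact pp_add0 : left_id pp_zero pp_add.
Proof. by move=> x; apply: preperf_eq => i /=; rewrite add0r. Qed.
Fact pp_addN : left_inverse pp_zero pp_opp pp_add.
Proof. by move=> x; apply: preperf_eq => i /=; rewrite addNr. Qed.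

HB.instance Definition _ := GRing.isZmodule.Build preperf
  pp_addA pp_addC pp_add0 pp_addN.

Fact pp_mulA : associative pp_mul.
Proof. by move=> x y z; apply: preperf_eq => i /=; rewrite mulrA. Qed.
Fact pp_mulC : commutative pp_mul.
Proof. by move=> x y; apply: preperf_eq => i /=; rewrite mulrC. Qed.
Fact pp_mul1 : left_id pp_one pp_mul.
Proof. by move=> x; apply: preperf_eq => i /=; rewrite mul1r. Qed.
Fact pp_mulDl : left_distributive pp_mul +%R.
Proof. by move=> x y z; apply: preperf_eq => i /=; rewrite mulrDl. Qed.
Fact pp_1neq0 : pp_one != 0.
Proof. by apply/eqP => /(congr1 (fun x : preperf => x 0%N)) /eqP; rewrite oner_eq0. Qed.

HB.instance Definition _ := GRing.Zmodule_isComNzRing.Build preperf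
  pp_mulA pp_mulC pp_mul1 pp_mulDl pp_1neq0.

Fact pp_scaleA a b x : pp_scale a (pp_scale b x) = pp_scale (a * b) x.
Proof. by apply: preperf_eq => i /=; rewrite scalerA. Qed.
Fact pp_scale1 : left_id 1 pp_scale.
Proof. by move=> x; apply: preperf_eq => i /=; rewrite scale1r. Qed.
Fact pp_scaleDr : right_distributive pp_scale +%R.
Proof. by move=> a x y; apply: preperf_eq => i /=; rewrite scalerDr. Qed.
Fact pp_scaleDl x : {morph pp_scale^~ x : a b / a + b}.
Proof. by move=> a b; apply: preperf_eq => i /=; rewrite scalerDl. Qed.

HB.instance Definition _ := GRing.Zmodule_isLmodule.Build R preperf
  pp_scaleA pp_scale1 pp_scaleDr pp_scaleDl.

Fact pp_scaleAl (a : R) (x y : preperf) : a *: (x * y) = (a *: x) * y.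
Proof. by apply: preperf_eq => i /=; rewrite scalerAl. Qed.

HB.instance Definition _ := GRing.Lmodule_isLalgebra.Build R preperf pp_scaleAl.
HB.instance Definition _ := GRing.Lalgebra_isComAlgebra.Build R preperf.

Definition pp_proj (x : preperf) : B := ftwist0_to (x 0%N).

Fact pp_proj_is_zmod : zmod_morphism pp_proj.
Proof. by move=> x y; rewrite /pp_proj rmorphB. Qed.
Fact pp_proj_is_monoid : monoid_morphism pp_proj.
Proof. by split=> [|x y]; rewrite /pp_proj ?rmorph1 ?rmorphM. Qed.
Fact pp_proj_is_scalable : scalable pp_proj.
Proof. by move=> a x; rewrite /pp_proj linearZ. Qed.

HB.instance Definition _ := GRing.isZmodMorphism.Build preperf B pp_proj pp_proj_is_zmod.
HB.instance Definition _ := GRing.isMonoidMorphism.Build preperf B pp_proj pp_proj_is_monoid.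
HB.instance Definition _ := GRing.isScalable.Build R preperf B *:%R pp_proj pp_proj_is_scalable.

End Preperfection.

End FrobeniusTwist.

Section Ideals.

Variables (S : comNzRingType) (s : seq S).

Definition gen_ideal : {pred S} :=
  fun x => `[< exists c : 'I_(size s) -> S, x = \sum_k c k * s`_k >].

Lemma gen_idealP x :
  reflect (exists c : 'I_(size s) -> S, x = \sum_k c k * s`_k) (x \in gen_ideal).
Proof. exact: asboolP. Qed.

Lemma gen_ideal_proper (S' : nzRingType) (f : {rmorphism S -> S'}) :
  {in s, forall x, f x = 0} -> 1 \notin gen_ideal.
Proof.
move=> fs; apply/negP => /gen_idealP[c /(congr1 f)].
rewrite rmorph1 rmorph_sum big1 => [/eqP|k _]; first by rewrite oner_eq0.
by rewrite rmorphM [f s`_k]fs ?mulr0 // mem_nth.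
Qed.

Lemma gen_idealr_closed : 1 \notin gen_ideal -> idealr_closed gen_ideal.
Proof.
split=> //.
  by apply/gen_idealP; exists (fun=> 0); rewrite big1 // => k _; rewrite mul0r.
move=> a x y /gen_idealP[c ->] /gen_idealP[d ->].
apply/gen_idealP; exists (fun k => a * c k + d k).
rewrite mulr_sumr -big_split /=; apply: eq_bigr => k _.
by rewrite mulrDl mulrA.
Qed.

End Ideals.

Lemma gen_ideal2P (S : comNzRingType) (a b x : S) :
  reflect (exists c d, x = c * a + d * b) (x \in gen_ideal [:: a; b]).
Proof.
apply: (iffP (gen_idealP _ _)) => [[c ->]|[c [d ->]]].
  by exists (c ord0), (c (lift ord0 ord0)); rewrite big_ord_recl big_ord1.
by exists (fun k => [:: c; d]`_k); rewrite big_ord_recl big_ord1.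
Qed.

Section AlgebraQuotient.

Variables (K : comNzRingType) (S : comAlgType K) (I : idealr S).

Local Notation Q := {ideal_quot I}.

(* S/I as a K-algebra through K -> S -> S/I. *)
Definition quot_scale (a : K) (x : Q) : Q := \pi_Q a%:A * x.

Fact quot_scaleA a b x : quot_scale a (quot_scale b x) = quot_scale (a * b) x.
Proof. by rewrite /quot_scale mulrA -rmorphM /= mulr_algl scalerA. Qed.
Fact quot_scale1 : left_id 1 quot_scale.
Proof. by move=> x; rewrite /quot_scale scale1r rmorph1 mul1r. Qed.
Fact quot_scaleDr : right_distributive quot_scale +%R.
Proof. by move=> a x y; rewrite /quot_scale mulrDr. Qed.
Fact quot_scaleDl x : {morph quot_scale^~ x : a b / a + b}.
Proof. by move=> a b; rewrite /quot_scale scalerDl rmorphD mulrDl. Qed.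

HB.instance Definition _ := GRing.Zmodule_isLmodule.Build K (Quotient.quot I)
  quot_scaleA quot_scale1 quot_scaleDr quot_scaleDl.

Fact quot_scaleAl (a : K) (x y : Q) : a *: (x * y) = (a *: x) * y.
Proof. exact: mulrA. Qed.

HB.instance Definition _ :=
  GRing.Lmodule_isLalgebra.Build K (Quotient.quot I) quot_scaleAl.
HB.instance Definition _ := GRing.Lalgebra_isComAlgebra.Build K (Quotient.quot I).

End AlgebraQuotient.

(* k[[u,v]]: [fps2_coef f m n] is the coefficient of u^m v^n. *)
Section PowerSeries.

Variable k : comNzRingType.

Record fps2 := Fps2 { fps2_coef : nat -> nat -> k }.

HB.instance Definition _ := gen_eqMixin fps2.
HB.instance Definition _ := gen_choiceMixin fps2.

Local Notation "f .@ ( m , n )" := (fps2_coef f m n)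
  (at level 2, format "f .@ ( m ,  n )").

Lemma fps2P (f g : fps2) : (forall m n, f.@(m, n) = g.@(m, n)) -> f = g.
Proof.
case: f g => [f] [g] /= e; congr Fps2.
by apply/funext => m; apply/funext => n.
Qed.

Definition fps2_zero := Fps2 (fun _ _ => 0).
Definition fps2_opp f := Fps2 (fun m n => - f.@(m, n)).
Definition fps2_add f g := Fps2 (fun m n => f.@(m, n) + g.@(m, n)).
Definition fps2_one := Fps2 (fun m n => ((m == 0%N) && (n == 0%N))%:R).
Definition fps2_mul f g := Fps2 (fun m n =>
  \sum_(i < m.+1) \sum_(j < n.+1) f.@(i, j) * g.@(m - i, n - j)%N).

Fact fps2_addA : associative fps2_add.
Proof. by move=> f g h; apply: fps2P => m n /=; rewrite addrA. Qed.
Fact fps2_addC : commutative fps2_add.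
Proof. by move=> f g; apply: fps2P => m n /=; rewrite addrC. Qed.
Fact fps2_add0 : left_id fps2_zero fps2_add.
Proof. by move=> f; apply: fps2P => m n /=; rewrite add0r. Qed.
Fact fps2_addN : left_inverse fps2_zero fps2_opp fps2_add.
Proof. by move=> f; apply: fps2P => m n /=; rewrite addNr. Qed.

HB.instance Definition _ := GRing.isZmodule.Build fps2
  fps2_addA fps2_addC fps2_add0 fps2_addN.

(* Truncation to polynomials, used to transfer the ring axioms. *)
Definition fps2_trunc (N : nat) (f : fps2) : {poly {poly k}} :=
  \poly_(i < N) \poly_(j < N) f.@(i, j).

Lemma coef_fps2_trunc N f m n : (m < N)%N -> (n < N)%N ->
  (fps2_trunc N f)`_m`_n = f.@(m, n).
Proof. by move=> mN nN; rewrite coef_poly mN coef_poly nN. Qed.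

Lemma coef2M (P Q : {poly {poly k}}) m n :
  (P * Q)`_m`_n = \sum_(i < m.+1) \sum_(j < n.+1) P`_i`_j * Q`_(m - i)`_(n - j).
Proof. by rewrite coefM coef_sum; apply: eq_bigr => i _; rewrite coefM. Qed.

Lemma eq_fps2_mul N (P Q : {poly {poly k}}) f g :
  (forall m n, (m < N)%N -> (n < N)%N -> P`_m`_n = f.@(m, n)) ->
  (forall m n, (m < N)%N -> (n < N)%N -> Q`_m`_n = g.@(m, n)) ->
  (forall m n, (m < N)%N -> (n < N)%N -> (P * Q)`_m`_n = (fps2_mul f g).@(m, n)).
Proof.
move=> eP eQ m n mN nN; rewrite coef2M /=.
apply: eq_bigr => i _; apply: eq_bigr => j _; rewrite eP ?eQ //.
- exact: leq_ltn_trans (leq_subr _ _) mN.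
- exact: leq_ltn_trans (leq_subr _ _) nN.
- exact: leq_ltn_trans (leq_ord i) mN.
- exact: leq_ltn_trans (leq_ord j) nN.
Qed.

Fact fps2_mulA : associative fps2_mul.
Proof.
move=> f g h; apply: fps2P => m n; pose N := (maxn m n).+1.
have mN : (m < N)%N by rewrite ltnS leq_maxl.
have nN : (n < N)%N by rewrite ltnS leq_maxr.
have T := coef_fps2_trunc.
rewrite -(eq_fps2_mul (T N f) (eq_fps2_mul (T N g) (T N h))) //.
by rewrite -(eq_fps2_mul (eq_fps2_mul (T N f) (T N g)) (T N h)) // mulrA.
Qed.

Fact fps2_mulC : commutative fps2_mul.
Proof.
move=> f g; apply: fps2P => m n; pose N := (maxn m n).+1.
have mN : (m < N)%N by rewrite ltnS leq_maxl.
have nN : (n < N)%N by rewrite ltnS leq_maxr.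
have T := coef_fps2_trunc.
by rewrite -(eq_fps2_mul (T N f) (T N g)) // -(eq_fps2_mul (T N g) (T N f)) // mulrC.
Qed.

Fact fps2_mul1 : left_id fps2_one fps2_mul.
Proof.
move=> f; apply: fps2P => m n /=.
rewrite big_ord_recl [X in _ + X]big1 ?addr0 => [|i _]; last first.
  by rewrite big1 // => j _ /=; rewrite mul0r.
rewrite big_ord_recl [X in _ + X]big1 ?addr0 => [|j _]; last by rewrite /= mul0r.
by rewrite mul1r !subn0.
Qed.

Fact fps2_mulDl : left_distributive fps2_mul +%R.
Proof.
move=> f g h; apply: fps2P => m n /=.
rewrite -big_split; apply: eq_bigr => i _; rewrite -big_split.
by apply: eq_bigr => j _; rewrite /= mulrDl.
Qed.

Fact fps2_1neq0 : fps2_one != 0.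
Proof. by apply/eqP => /(congr1 (fun f => f.@(0, 0)%N)) /eqP; rewrite oner_eq0. Qed.

HB.instance Definition _ := GRing.Zmodule_isComNzRing.Build fps2
  fps2_mulA fps2_mulC fps2_mul1 fps2_mulDl fps2_1neq0.

Definition fps2_u : fps2 := Fps2 (fun m n => ((m == 1%N) && (n == 0%N))%:R).
Definition fps2_v : fps2 := Fps2 (fun m n => ((m == 0%N) && (n == 1%N))%:R).

Definition fps2_const (f : fps2) : k := f.@(0, 0)%N.

Fact fps2_const_is_zmod : zmod_morphism fps2_const.
Proof. by []. Qed.
Fact fps2_const_is_monoid : monoid_morphism fps2_const.
Proof. by split=> // f g; rewrite /fps2_const /= !big_ord1. Qed.

HB.instance Definition _ :=
  GRing.isZmodMorphism.Build fps2 k fps2_const fps2_const_is_zmod.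
HB.instance Definition _ :=
  GRing.isMonoidMorphism.Build fps2 k fps2_const fps2_const_is_monoid.

Lemma fps2_natr (a : nat) m n :
  (a%:R : fps2).@(m, n) = if (m == 0%N) && (n == 0%N) then a%:R else 0.
Proof.
elim: a => [|a IH]; first by case: ifP.
by rewrite !mulrS /= IH /=; case: ifP; rewrite ?addr0.
Qed.

End PowerSeries.

Section BaseRing.

Variable p : nat.

Definition uv_ideal := gen_ideal [:: fps2_u 'F_p * fps2_v 'F_p].

Fact uv_ideal_proper : 1 \notin uv_ideal.
Proof.
apply: (@gen_ideal_proper _ _ _ (fps2_const (k := 'F_p))) => x.
by rewrite inE => /eqP ->; rewrite rmorphM /= mul0r.
Qed.

HB.instance Definition _ :=
  isIdealr.Build (fps2 'F_p) uv_ideal (gen_idealr_closed uv_ideal_proper).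

(* R = F_p[[u,v]]/(uv) *)
Definition Ruv := {ideal_quot uv_ideal}.

HB.instance Definition _ := GRing.ComNzRing.on Ruv.

Definition Ru : Ruv := \pi_{ideal_quot uv_ideal} (fps2_u 'F_p).
Definition Rv : Ruv := \pi_{ideal_quot uv_ideal} (fps2_v 'F_p).

Lemma pchar_Ruv : prime p -> p \in [pchar Ruv].
Proof.
move=> hp; rewrite inE hp /= -(rmorph_nat \pi_{ideal_quot uv_ideal}).
suff -> : p%:R = 0 :> fps2 'F_p by rewrite rmorph0.
apply: fps2P => m n; rewrite fps2_natr; case: ifP => //= _.
by apply/eqP; have := pchar_Fp hp; rewrite inE => /andP[].
Qed.

Lemma Ruv_uv : Ru * Rv = 0.
Proof.
rewrite -rmorphM; apply/eqP; rewrite -(rmorph0 \pi_{ideal_quot uv_ideal}).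
rewrite -Quotient.idealrBE subr0; apply/gen_idealP; exists (fun=> 1).
by rewrite big_ord1 mul1r.
Qed.

End BaseRing.

Section Algebras.

Variables (K : comNzRingType) (u v : K).

(* Variables 0, 1, 2 are x, y and the adjoined inverse of x - y. *)
Definition px : {mpoly K[3]} := 'X_(inord 0).
Definition py : {mpoly K[3]} := 'X_(inord 1).
Definition pz : {mpoly K[3]} := 'X_(inord 2).

Definition A_ideal := gen_ideal [:: px * py - u%:MP; (px - py) * pz - 1].

(* Under x, y, z |-> X, X - 1, 1 in K[X], the ideal maps onto the one         *)
(* generated by the monic polynomial X (X - 1) - u.                           *)
Fact A_ideal_proper : 1 \notin A_ideal.
Proof.
pose h (i : 'I_3) : {poly K} := [:: 'X; 'X - 1%:P; 1]`_i.
have E (i : 'I_3) : mmap polyC h 'X_i = h i by rewrite mmapX mmap1U.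
have Ex : mmap polyC h px = 'X by rewrite E /h inordK.
have Ey : mmap polyC h py = 'X - 1%:P by rewrite E /h inordK.
have Ez : mmap polyC h pz = 1 by rewrite E /h inordK.
apply/negP => /gen_ideal2P[c [d /(congr1 (mmap polyC h))]].
rewrite rmorph1 rmorphD !rmorphM !rmorphB !rmorphM rmorphB rmorph1 /=.
rewrite Ex Ey Ez mmapC subKr mulr1 subrr mulr0 addr0.
move: (mmap _ _ c) => {d} q.
have szf : size ('X * ('X - 1%:P) - u%:P : {poly K}) = 3%N.
  rewrite size_polyDl size_monicM ?monicX ?polyXsubC_eq0 // size_polyX size_XsubC //.
  by rewrite size_polyN (leq_ltn_trans (size_polyC_leq1 _)).
have fmon : 'X * ('X - 1%:P) - u%:P \is monic.
  rewrite monicE lead_coefDl ?size_polyN.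
    by rewrite lead_coef_monicM ?monicX // lead_coefXsubC.
  rewrite size_monicM ?monicX ?polyXsubC_eq0 // size_polyX size_XsubC.
  exact: leq_ltn_trans (size_polyC_leq1 _) _.
have [->|q0] := eqVneq q 0; first by rewrite mul0r => /eqP; rewrite oner_eq0.
move=> /(congr1 (size \o polyseq)) /=; rewrite size_Mmonic // szf size_poly1 addn3 /=.
by case: (size q) (size_poly_eq0 q) => //; rewrite (negbTE q0).
Qed.

HB.instance Definition _ :=
  isIdealr.Build {mpoly K[3]} A_ideal (gen_idealr_closed A_ideal_proper).

(* K[x, y, (x-y)^-1]/(xy - u), as K[x, y, z]/(xy - u, (x - y) z - 1) *)
Definition Axy := {ideal_quot A_ideal}.

HB.instance Definition _ := GRing.ComAlgebra.on Axy.

Definition Ax : Axy := \pi_{ideal_quot A_ideal} px.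
Definition Ay : Axy := \pi_{ideal_quot A_ideal} py.
Definition Axy_inv : Axy := \pi_{ideal_quot A_ideal} pz.

(* The hypothesis u v = 0 makes the ideal proper: it vanishes at alpha = v. *)
Definition C_ideal of u * v = 0 :=
  gen_ideal [:: u%:P * 'X; (v ^+ 2)%:P - 'X^2 : {poly K}].

Hypothesis huv : u * v = 0.

Fact C_ideal_proper : 1 \notin C_ideal huv.
Proof.
apply: (@gen_ideal_proper _ _ _ (horner_eval v)) => f.
rewrite !inE => /orP[] /eqP -> /=; rewrite /horner_eval.
  by rewrite hornerM hornerC hornerX.
by rewrite hornerD hornerN hornerC hornerXn subrr.
Qed.

HB.instance Definition _ :=
  isIdealr.Build {poly K} (C_ideal huv) (gen_idealr_closed C_ideal_proper).

(* K[alpha]/(u alpha, v^2 - alpha^2) *)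
Definition Calpha := {ideal_quot (C_ideal huv)}.

HB.instance Definition _ := GRing.ComAlgebra.on Calpha.

Definition alpha : Calpha := \pi_{ideal_quot (C_ideal huv)} 'X.

End Algebras.

(* Main.v *)
(** Over each level A^{p^i/R} = R[x, y, (x-y)^-1]/(xy - u^q), q = p^i, every
    element s satisfies E(x) s = P(x) with E monic and E(x) dividing a power of
    x, while x is transcendental over R.  An element of the limit satisfies such
    an equation at level 0 with E and P polynomials in x^q, for every q; for q
    large this forces P = c E, so that s = c up to x-power torsion.  Likewise
    s = d up to y-power torsion, and since x - y is a unit, (c, d) determines s.
    As xy = u, the difference c - d is killed by a power of u, hence lies in vR;
    with alpha = v (x+y)/(x-y), which is v up to x-torsion and -v up to
    y-torsion, this gives s = a + b alpha with c = a + b v and d = a - b v.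

    For the second preperfection, alpha^p = v^(q(p-1)) alpha over the level
    p^i = q of the twists of R[alpha]/(u alpha, v^2 - alpha^2), so the
    alpha-coordinate of a compatible sequence, well defined modulo u^q, is
    divisible by all powers of v modulo u^q, hence vanishes. *)

From HB Require Import structures.
Require Import Defs.
From mathcomp Require Import all_boot all_order all_algebra.
From mathcomp Require Import ring_quotient boolp.
From mathcomp Require Import mpoly.
From mathcomp Require Import ring.

Set Implicit Arguments.
Unset Strict Implicit.
Unset Printing Implicit Defensive.

Import GRing.Theory.
Local Open Scope ring_scope.

(** * Quotients of algebras and maps out of them *)

Section QuotientAlgebra.

Local Open Scope quotient_scope.

Variables (K : comNzRingType) (S : comAlgType K) (I : idealr S).

Definition quot_map (f : S) : {ideal_quot I} := \pi_{ideal_quot I} f.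

Fact quot_map_is_zmod : zmod_morphism quot_map.
Proof. exact: rmorphB. Qed.
Fact quot_map_is_monoid : monoid_morphism quot_map.
Proof. by split=> [|f g]; rewrite /quot_map ?rmorph1 ?rmorphM. Qed.
Fact quot_map_is_scalable : scalable quot_map.
Proof. by move=> a f; rewrite -mulr_algl [LHS]rmorphM. Qed.

HB.instance Definition _ :=
  GRing.isZmodMorphism.Build S {ideal_quot I} quot_map quot_map_is_zmod.
HB.instance Definition _ :=
  GRing.isMonoidMorphism.Build S {ideal_quot I} quot_map quot_map_is_monoid.
HB.instance Definition _ :=
  GRing.isScalable.Build K S {ideal_quot I} *:%R quot_map quot_map_is_scalable.

Lemma quot_map_eq f g : quot_map f = quot_map g <-> f - g \in I.
Proof. by rewrite Quotient.idealrBE; split=> [/eqP|/eqP]. Qed.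

Lemma quot_map_repr x : quot_map (repr x) = x.
Proof. exact: reprK. Qed.

Lemma repr_quot_map f : repr (quot_map f) - f \in I.
Proof. exact/quot_map_eq/quot_map_repr. Qed.

Section QuotientLift.

Variables (T : comAlgType K) (h : {lrmorphism S -> T}).

(** The vanishing proof is an argument so that the morphism structures below, which depend on it,
    can be attached to the map. *)
Definition quot_lift of {in I, forall f, h f = 0} :=
  fun x : {ideal_quot I} => h (repr x) : T.

Hypothesis hI : {in I, forall f, h f = 0}.

Local Notation lift := (quot_lift hI).

Lemma quot_liftE f : lift (quot_map f) = h f.
Proof. by apply/eqP; rewrite -subr_eq0 -(rmorphB h); apply/eqP/hI/repr_quot_map. Qed.

Fact quot_lift_is_zmod : zmod_morphism lift.
Proof.
move=> x y; rewrite -[x]quot_map_repr -[y]quot_map_repr.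
by rewrite -rmorphB !quot_liftE rmorphB.
Qed.
Fact quot_lift_is_monoid : monoid_morphism lift.
Proof.
split=> [|x y]; first by rewrite -[1 in LHS](rmorph1 quot_map) quot_liftE rmorph1.
rewrite -[x]quot_map_repr -[y]quot_map_repr.
by rewrite -rmorphM !quot_liftE rmorphM.
Qed.
Fact quot_lift_is_scalable : scalable lift.
Proof.
by move=> a x; rewrite -[x]quot_map_repr -linearZ !quot_liftE linearZ.
Qed.

HB.instance Definition _ :=
  GRing.isZmodMorphism.Build {ideal_quot I} T lift quot_lift_is_zmod.
HB.instance Definition _ :=
  GRing.isMonoidMorphism.Build {ideal_quot I} T lift quot_lift_is_monoid.
HB.instance Definition _ :=
  GRing.isScalable.Build K {ideal_quot I} T *:%R lift quot_lift_is_scalable.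

End QuotientLift.

End QuotientAlgebra.

(** * Descent along the relative Frobenius maps *)

(** [K[X]] is free over [K[X^q]] on [1, ..., X^(q-1)]: as [P] has degree below [q], uniqueness of
    division by [q] leaves a single term in the convolution. *)
Lemma coef_mul_comp_Xn (K : nzRingType) (P Q : {poly K}) q i m :
  (0 < q)%N -> (size P <= q)%N -> (i < q)%N ->
  (P * (Q \Po 'X^q))`_(m * q + i) = P`_i * Q`_m.
Proof.
move=> q0 szP iq; rewrite coefM.
have iS : (i < (m * q + i).+1)%N by rewrite ltnS leq_addl.
rewrite (bigD1 (Ordinal iS)) //= addnK coef_comp_poly_Xn // dvdn_mull // mulnK //.
rewrite big1 ?addr0 // => j /negP ji; rewrite coef_comp_poly_Xn //.
have [jq|jq] := ltnP j q; last first.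
  by rewrite nth_default ?mul0r // (leq_trans szP).
case: ifP => [dq|]; last by rewrite mulr0.
case: ji; apply/eqP/val_inj => /=; move: dq.
rewrite -(eqn_mod_dvd _ (ltn_ord j : j <= _)%N) modnMDl.
by rewrite !modn_small // => /eqP.
Qed.

(** Comparing coefficients of [X^(m q + i)] gives [P_i E'_m = E_i P'_m]; at [m = deg E'] the left
    factor [E'_m] is 1, so [c] is the coefficient of [P'] there. *)
Lemma proportional_of_large_exponent (K : nzRingType) (E P E' P' : {poly K}) q :
  E \is monic -> E' \is monic -> (size E <= q)%N -> (size P <= q)%N ->
  P * (E' \Po 'X^q) = E * (P' \Po 'X^q) -> exists c, P = E * c%:P.
Proof.
move=> mE mE' szE szP eqPE.
have E0 : (0 < size E)%N by rewrite size_poly_gt0 monic_neq0.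
have q0 : (0 < q)%N by apply: leq_trans szE.
have Eq : ((size E).-1 < q)%N by rewrite prednK.
have step i m : (i < q)%N -> P`_i * E'`_m = E`_i * P'`_m.
  by move=> iq; rewrite -(coef_mul_comp_Xn _ _ q0 szP iq) eqPE coef_mul_comp_Xn.
pose n := (size E').-1; exists P'`_n; apply/polyP => i; rewrite coefMC.
have [iq|iq] := ltnP i q; first by rewrite -step // [E'`_n](monicP mE') mulr1.
by rewrite (nth_default _ (leq_trans szP iq)) (nth_default _ (leq_trans szE iq)) mul0r.
Qed.

Section PolynomialFractions.

Variables (K : comNzRingType) (B : comAlgType K) (x : B).

Local Notation ev := (horner_alg x).

(** [s] is the fraction [P(x)/E(x)] once [x] is inverted. Monicity of [E] serves the comparison of
    coefficients; the cofactor [t] turns torsion for [E(x)] into [x]-power torsion. *)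
Definition poly_fraction (s : B) : Prop :=
  exists k E t P, [/\ E \is monic, ev E * t = x ^+ k & ev E * s = ev P].

Lemma poly_fraction_alg a : poly_fraction a%:A.
Proof.
by exists 0%N, 1, 1, a%:P; split; rewrite ?monic1 ?rmorph1 ?mul1r //= horner_algC.
Qed.

Lemma poly_fraction_var : poly_fraction x.
Proof. by exists 0%N, 1, 1, 'X; split; rewrite ?monic1 ?rmorph1 ?mul1r ?horner_algX. Qed.

Lemma poly_fractionD s s' :
  poly_fraction s -> poly_fraction s' -> poly_fraction (s + s').
Proof.
move=> [k [E [t [P [mE eE eP]]]]] [k' [E' [t' [P' [mE' eE' eP']]]]].
exists (k + k')%N, (E * E'), (t * t'), (E' * P + E * P').
split; rewrite ?monicMr //; first by rewrite rmorphM /= mulrACA eE eE' exprD.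
by rewrite rmorphD !rmorphM /= mulrDr -eP -eP' !mulrA (mulrC (ev E')).
Qed.

Lemma poly_fractionM s s' :
  poly_fraction s -> poly_fraction s' -> poly_fraction (s * s').
Proof.
move=> [k [E [t [P [mE eE eP]]]]] [k' [E' [t' [P' [mE' eE' eP']]]]].
exists (k + k')%N, (E * E'), (t * t'), (P * P').
by split; rewrite ?monicMr // rmorphM mulrACA ?eE ?eE' ?exprD // eP eP' rmorphM.
Qed.

Lemma poly_fractionZ a s : poly_fraction s -> poly_fraction (a *: s).
Proof. by move=> fs; rewrite -mulr_algl; apply/poly_fractionM/fs/poly_fraction_alg. Qed.

Lemma poly_fraction_other w y : x * y = w%:A -> poly_fraction y.
Proof.
move=> xy; exists 1%N, 'X, 1, w%:P.
by rewrite monicX mulr1 horner_algX horner_algC.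
Qed.

(** Since [x^2 - w = x (x - y)], multiplying by [z] gives [(x^2 - w) z = x], so the denominator
    [X^2 - w] divides [x] with cofactor [z] itself. *)
Lemma poly_fraction_inv w y z :
  x * y = w%:A -> (x - y) * z = 1 -> poly_fraction z.
Proof.
move=> xy xyz; exists 1%N, ('X^2 - w%:P), z, 'X; rewrite horner_algX expr1.
suff e : ev ('X^2 - w%:P) * z = x.
  split=> //; rewrite monicE lead_coefDl ?lead_coefXn // size_polyN size_polyXn.
  exact: leq_ltn_trans (size_polyC_leq1 _) _.
rewrite rmorphB rmorphXn /= horner_algX horner_algC expr2 -xy -mulrBr -mulrA.
by rewrite xyz mulr1.
Qed.

End PolynomialFractions.

Section Descent.

Variables (p : nat) (p_gt1 : (1 < p)%N) (K : comNzRingType).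
Variables (B : nat -> comAlgType K) (F : forall i, {lrmorphism B i.+1 -> B i}).
Variable (x : forall i, B i).
Hypotheses (Fx : forall i, F i (x i.+1) = x i ^+ p).
Hypothesis x_inj : forall i P, horner_alg (x i) P = 0 -> P = 0.
Hypothesis x_gen : forall i s, poly_fraction (x i) s.

Lemma lrmorph_horner_alg i P :
  F i (horner_alg (x i.+1) P) = horner_alg (x i) (P \Po 'X^p).
Proof.
elim/poly_ind: P => [|P c IH]; first by rewrite comp_poly0 !rmorph0.
rewrite comp_polyD comp_polyM comp_polyX comp_polyC !rmorphD !rmorphM /= IH.
rewrite rmorphXn /= !horner_algX !horner_algC Fx.
by rewrite linearZ /= rmorph1.
Qed.

(** A fraction for [s (i + n)] is pushed down [n] times: [F] fixes the coefficients and sends [x] to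
    [x^p], so each step substitutes [X^p] for [X]. *)
Lemma poly_fraction_Xn (s : forall i, B i) :
  (forall i, F i (s i.+1) = s i) ->
  forall n i, exists E P, E \is monic /\
    horner_alg (x i) (E \Po 'X^(p ^ n)) * s i = horner_alg (x i) (P \Po 'X^(p ^ n)).
Proof.
move=> Fs; elim=> [|n IH] i.
  have [k [E [t [P [mE _ eP]]]]] := x_gen (s i).
  by exists E, P; rewrite expn0 expr1 !comp_polyXr.
have [E [P [mE eP]]] := IH i.+1; exists E, P; split=> //.
have := congr1 (F i) eP; rewrite rmorphM /= Fs !lrmorph_horner_alg.
by rewrite -!comp_polyA comp_Xn_poly -exprM mulnC -expnSr.
Qed.

(** Two fractions for [s i], one in [x] and one in [x^q], are cross-multiplied; transcendence of [x]
    makes this a polynomial identity, and [q = p^n] exceeds the sizes of [E] and [P], so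
    [P = c E]. *)
Lemma constant_up_to_torsion_at (s : forall i, B i) :
  (forall i, F i (s i.+1) = s i) ->
  forall i, exists c k, x i ^+ k * (s i - c%:A) = 0.
Proof.
move=> Fs i; have [k [E [t [P [mE eE eP]]]]] := x_gen (s i).
pose n := maxn (size E) (size P).
have nq : (n <= p ^ n)%N by rewrite ltnW // ltn_expl.
have [E' [P' [mE' eP']]] := poly_fraction_Xn Fs n i.
have eqP : P * (E' \Po 'X^(p ^ n)) = E * (P' \Po 'X^(p ^ n)).
  apply/eqP; rewrite -subr_eq0; apply/eqP/(@x_inj i).
  rewrite rmorphB !rmorphM /= -eP -eP' -!mulrA (mulrC (s i)) subrr //.
have [||c ePc] := proportional_of_large_exponent mE mE' _ _ eqP.
- by rewrite (leq_trans _ nq) // leq_maxl.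
- by rewrite (leq_trans _ nq) // leq_maxr.
(* [E(x) (s i - c) = 0], and [x^k] is a multiple of [E(x)]. *)
exists c, k; rewrite -eE mulrAC mulrBr eP ePc rmorphM /= horner_algC.
by rewrite subrr mul0r.
Qed.

Lemma torsion_const i c k : x i ^+ k * c%:A = 0 -> c = 0.
Proof.
move=> e; have : horner_alg (x i) ('X^k * c%:P) = 0.
  by rewrite rmorphM rmorphXn /= horner_algX horner_algC.
move=> /x_inj /(congr1 (fun P : {poly K} => P`_k)).
by rewrite coefMC coefXn eqxx mul1r coef0.
Qed.

Lemma constant_up_to_torsion (s : forall i, B i) :
  (forall i, F i (s i.+1) = s i) ->
  exists c, forall i, exists k, x i ^+ k * (s i - c%:A) = 0.
Proof.
move=> Fs; have [c [k0 ec]] := constant_up_to_torsion_at Fs 0.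
exists c => i; have [d [k ed]] := constant_up_to_torsion_at Fs i.
suff -> : c = d by exists k.
(* The relation for [d] descends from level [i] to level 0, the exponent being multiplied by [p] at
   each step; there [c - d] is [x]-power torsion, hence 0. *)
have [l el] : exists l, x 0 ^+ l * (s 0%N - d%:A) = 0.
  clear ec; elim: i k ed => [|i IH] k ed; first by exists k.
  apply: (IH (p * k)%N); have := congr1 (F i) ed.
  by rewrite rmorphM rmorphXn rmorphB /= Fs Fx rmorph_alg rmorph0 exprM.
apply/eqP; rewrite -subr_eq0; apply/eqP/(@torsion_const 0%N _ (k0 + l)%N).
rewrite scalerBl; have -> : c%:A - d%:A = (s 0%N - d%:A) - (s 0%N - c%:A) :> B 0.
  by rewrite opprB [RHS]addrC addrA subrK.
by rewrite exprD mulrBr -mulrA el mulr0 [X in _ - X]mulrAC ec mul0r subr0.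
Qed.

End Descent.

(** * The twists of the algebra A *)

Section FrobeniusMorphism.

Variables (p : nat) (K : comNzRingType) (hK : p \in [pchar K]) (i : nat).

Fact frobn_is_zmod : zmod_morphism (frobn hK i).
Proof. by elim: i => // n IH a b; rewrite /frobn /= -!/(frobn hK n _) IH rmorphB. Qed.

Fact frobn_is_monoid : monoid_morphism (frobn hK i).
Proof. by split=> [|a b]; rewrite ?frobnM // frobnE expr1n. Qed.

HB.instance Definition _ := GRing.isZmodMorphism.Build K K (frobn hK i) frobn_is_zmod.
HB.instance Definition _ :=
  GRing.isMonoidMorphism.Build K K (frobn hK i) frobn_is_monoid.

Lemma ftwist_algE (B : comAlgType K) (a : K) : a%:A = tens hK i 1 a :> ftwist hK i B.
Proof. by rewrite -tens11 tensZ mulr1. Qed.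

Lemma tensE (B : comAlgType K) (b : B) r : tens hK i b r = r *: tens hK i b 1.
Proof. by rewrite tensZ mulr1. Qed.

Lemma tens1M (B : comAlgType K) (b b' : B) :
  tens hK i (b * b') 1 = tens hK i b 1 * tens hK i b' 1.
Proof. by rewrite tensM mulr1. Qed.

Lemma tens1X (B : comAlgType K) (b : B) n : tens hK i (b ^+ n) 1 = tens hK i b 1 ^+ n.
Proof. by elim: n => // n IH; rewrite !exprS tens1M IH. Qed.

Lemma tens1_alg (B : comAlgType K) (a : K) :
  tens hK i (a%:A : B) 1 = (a ^+ (p ^ i))%:A.
Proof. by rewrite tens_balE frobnE mulr1 ftwist_algE. Qed.

Lemma tens1Z (B : comAlgType K) (a : K) (b : B) :
  tens hK i (a *: b) 1 = a ^+ (p ^ i) *: tens hK i b 1.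
Proof. by rewrite tens_balE frobnE mulr1 tensE. Qed.

End FrobeniusMorphism.

Section Hyperbola.

Variables (K : comNzRingType) (u : K).

Definition Axy_pi : {mpoly K[3]} -> Axy u := @quot_map K {mpoly K[3]} (A_ideal u).

HB.instance Definition _ :=
  GRing.LRMorphism.copy Axy_pi (@quot_map K {mpoly K[3]} (A_ideal u)).

Lemma Axy_pi_surj b : exists g, Axy_pi g = b.
Proof. by exists (repr b); apply: quot_map_repr. Qed.

Lemma Axy_pi_eq f g : Axy_pi f = Axy_pi g <-> f - g \in A_ideal u.
Proof. exact: quot_map_eq. Qed.

Lemma Axy_alg c : Axy_pi c%:MP = c%:A.
Proof. by rewrite -alg_mpolyC linearZ rmorph1. Qed.

Lemma Axy_xy : Ax u * Ay u = u%:A.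
Proof.
rewrite -Axy_alg; have <- : Axy_pi (px K * py K) = Ax u * Ay u by rewrite rmorphM.
by apply/Axy_pi_eq/gen_ideal2P; exists 1, 0; rewrite mul1r mul0r addr0.
Qed.

Lemma Axy_xyz : (Ax u - Ay u) * Axy_inv u = 1.
Proof.
have <- : Axy_pi 1 = 1 by rewrite rmorph1.
have <- : Axy_pi ((px K - py K) * pz K) = (Ax u - Ay u) * Axy_inv u.
  by rewrite rmorphM rmorphB.
by apply/Axy_pi_eq/gen_ideal2P; exists 0, 1; rewrite mul1r mul0r add0r.
Qed.

(** Holds because [x], [y] and the inverse of [x - y] generate the algebra. *)
Lemma Axy_ind (Q : Axy u -> Prop) :
  (forall a, Q a%:A) -> (forall X Y, Q X -> Q Y -> Q (X + Y)) ->
  (forall X Y, Q X -> Q Y -> Q (X * Y)) ->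
  Q (Ax u) -> Q (Ay u) -> Q (Axy_inv u) -> forall X, Q X.
Proof.
move=> Qa QD QM Qx Qy Qz X; have [g <-] := Axy_pi_surj X.
elim/mpolyind: g => [|c m g _ _ IH].
  by rewrite rmorph0 -(scale0r 1); exact: Qa.
rewrite rmorphD; apply: (QD) IH; rewrite -mul_mpolyC rmorphM; apply: (QM).
  by rewrite /= Axy_alg; exact: Qa.
rewrite mpolyXE_id rmorph_prod /=; elim/big_rec: _ => [|j b _ IH].
  by rewrite -(scale1r 1); exact: Qa.
apply: (QM) IH; rewrite rmorphXn /=; elim: (m j) => [|n IH].
  by rewrite expr0 -(scale1r 1); exact: Qa.
rewrite exprS; apply: (QM) IH.
have e k : (k < 3)%N -> j = k :> nat -> Axy_pi 'X_j = Axy_pi 'X_(inord k).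
  by move=> k3 jk; congr (Axy_pi 'X_(_)); apply/val_inj; rewrite /= inordK.
case: j e => [[|[|[|//]]] hj] e; first by rewrite (e 0%N).
  by rewrite (e 1%N).
by rewrite (e 2%N).
Qed.

End Hyperbola.

Section HyperbolaTwist.

Variables (p : nat) (K : comNzRingType) (hK : p \in [pchar K]) (u : K) (i : nat).

Local Notation B := (ftwist hK i (Axy u)).
Local Notation w := (u ^+ (p ^ i)).
Local Notation t b := (tens hK i b 1).

Lemma twist_xy : t (Ax u) * t (Ay u) = w%:A.
Proof. by rewrite -tens1M Axy_xy tens1_alg. Qed.

Lemma twist_xyz : (t (Ax u) - t (Ay u)) * t (Axy_inv u) = 1.
Proof.
have -> : t (Ax u) - t (Ay u) = t (Ax u - Ay u).
  by apply/eqP; rewrite subr_eq -tensDl subrK.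
by rewrite -tens1M Axy_xyz.
Qed.

Lemma twist_ind (Q : B -> Prop) :
  (forall a, Q a%:A) -> (forall X Y, Q X -> Q Y -> Q (X + Y)) ->
  (forall X Y, Q X -> Q Y -> Q (X * Y)) ->
  Q (t (Ax u)) -> Q (t (Ay u)) -> Q (t (Axy_inv u)) -> forall X, Q X.
Proof.
move=> Qa QD QM Qx Qy Qz.
have QZ a X : Q X -> Q (a *: X) by rewrite -mulr_algl; exact: QM.
elim/ftwist_ind => [|//|b r]; first by rewrite -(scale0r 1); exact: Qa.
rewrite tensE; apply: QZ; elim/Axy_ind: b => // [a|b b' Qb Qb'|b b' Qb Qb'].
- by rewrite tens1_alg; exact: Qa.
- by rewrite tensDl; apply: QD.
- by rewrite tens1M; exact: QM.
Qed.

End HyperbolaTwist.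

(** * Transcendence of x and y over the base ring in every twist *)

Section TwistEvaluation.

Variables (p : nat) (K : comNzRingType) (hK : p \in [pchar K]) (u : K) (i : nat).

Local Notation B := (ftwist hK i (Axy u)).
Local Notation w := (u ^+ (p ^ i)).
Local Notation t b := (tens hK i b 1).
Local Notation rmodp := Pdiv.CommonRing.rmodp.

Variables (a b c M : {poly K}).
Hypotheses (mM : M \is monic).
Hypothesis abM : exists d, a * b = w%:P + d * M.
Hypothesis abcM : exists d, (a - b) * c = 1 + d * M.

Let h (j : 'I_3) : {poly K} := [:: a; b; c]`_j.
(** Coefficients pass through the [i]-th Frobenius, as balancing over the twisted scalars requires;
    in particular [u] becomes [w]. *)
Let ev (g : {mpoly K[3]}) : {poly K} := mmap (polyC \o frobn hK i) h g.

Lemma twist_ev_var g k : (k < 3)%N -> g = 'X_(inord k) -> ev g = [:: a; b; c]`_k.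
Proof. by move=> k3 ->; rewrite /ev mmapX mmap1U /h inordK. Qed.

Lemma twist_ev_ideal g : g \in A_ideal u -> exists d, ev g = d * M.
Proof.
have [d ed] := abM; have [d' ed'] := abcM.
move=> /gen_ideal2P [e [e' ->]]; exists (ev e * d + ev e' * d').
rewrite /ev rmorphD !rmorphM !rmorphB !rmorphM rmorphB rmorph1 /= -!/(ev _).
rewrite (@twist_ev_var (px K) 0%N) // (@twist_ev_var (py K) 1%N) //.
rewrite (@twist_ev_var (pz K) 2%N) //= /ev mmapC /= frobnE ed ed'.
by rewrite addrAC subrr add0r addrAC subrr add0r mulrDl !mulrA.
Qed.

(** The evaluation with values in [K[X]/(M)], its classes represented by remainders; [tens_lift]
    asks only for an additive target. *)
Definition twist_residue (s : Axy u) (r : K) : {poly K} := rmodp (r%:P * ev (repr s)) M.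

Lemma rmodp_mulMr (P d : {poly K}) : rmodp (P * (d * M)) M = 0.
Proof. by rewrite mulrA Pdiv.RingMonic.rmodp_mull. Qed.

Lemma twist_residueE g r : twist_residue (Axy_pi u g) r = rmodp (r%:P * ev g) M.
Proof.
have [d ed] := twist_ev_ideal (repr_quot_map (A_ideal u) g).
have -> : ev g = ev (repr (Axy_pi u g)) - d * M.
  by rewrite -ed /ev -rmorphB opprB addrC subrK.
by rewrite mulrBr Pdiv.RingMonic.rmodpB // rmodp_mulMr subr0.
Qed.

Lemma twist_residue_compatible : tens_compatible hK i twist_residue.
Proof.
split=> [s s' r|s r r'|k s r].
- have [f <-] := Axy_pi_surj s; have [g <-] := Axy_pi_surj s'.
  rewrite -rmorphD !twist_residueE /ev rmorphD mulrDr.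
  by rewrite Pdiv.RingMonic.rmodpD.
- by rewrite /twist_residue polyCD mulrDl Pdiv.RingMonic.rmodpD.
- have [f <-] := Axy_pi_surj s; rewrite -linearZ !twist_residueE /ev mmapZ /=.
  by rewrite mulrA -polyCM [r * _]mulrC.
Qed.

Lemma twist_residue_horner g P :
  tens_lift twist_residue (horner_alg (t (Axy_pi u g)) P) = rmodp (P \Po ev g) M.
Proof.
have comp := twist_residue_compatible.
rewrite -[P in LHS]coefK poly_def linear_sum comp_polyE /=.
elim/big_rec2: _ => [|j X Q _ IH].
  by rewrite tens_lift0 // Pdiv.CommonRing.rmod0p.
rewrite tens_liftD // Pdiv.RingMonic.rmodpD // IH; congr (_ + _).
rewrite linearZ /= rmorphXn /= horner_algX -tens1X mulr_algl -tensE tens_liftE //.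
by rewrite -rmorphXn twist_residueE mul_polyC /ev rmorphXn.
Qed.

(** The evaluation sends [P(g)] to [P] modulo [M], which is [P] itself by the size bound. *)
Lemma twist_horner_inj g (P : {poly K}) : (size P < size M)%N -> ev g = 'X ->
  horner_alg (t (Axy_pi u g)) P = 0 -> P = 0.
Proof.
move=> szP eg /(congr1 (tens_lift twist_residue)).
rewrite twist_residue_horner tens_lift0; last exact: twist_residue_compatible.
by rewrite eg comp_polyXr Pdiv.CommonRing.rmodp_small.
Qed.

End TwistEvaluation.

Section InvertingModulus.

Variables (K : comNzRingType) (w : K) (N : nat).

(* Modulo this monic polynomial both X and X^2 - w are invertible, while no
   nonzero polynomial of degree at most N vanishes. *)
Definition inv_modulus : {poly K} := 'X^N * ('X * ('X^2 - w%:P)) - 1.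
Definition inv_X : {poly K} := ('X^2 - w%:P) * 'X^N.

Local Notation M := inv_modulus.

Lemma inv_modulus_monic : M \is monic /\ size M = N.+4.
Proof.
pose D : {poly K} := 'X^2 - w%:P; pose E : {poly K} := 'X^N * ('X * D).
have [mD sD] : D \is monic /\ size D = 3%N.
  have sz : (size (- w%:P) < size ('X^2 : {poly K}))%N.
    by rewrite size_polyN size_polyXn (leq_ltn_trans (size_polyC_leq1 _)).
  by rewrite monicE lead_coefDl // lead_coefXn eqxx size_polyDl // size_polyXn.
have mE : E \is monic by rewrite !monicMl ?monicX ?monicXn.
have sE : size E = N.+4.
  rewrite size_monicM ?monicXn ?size_monicM ?monicX ?monic_neq0 ?monicMl ?monicX //.
  by rewrite size_polyXn size_polyX sD addnC.
have sz1 : (size (- 1 : {poly K})%R < size E)%N by rewrite sE size_polyN size_poly1.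
by rewrite monicE /inv_modulus lead_coefDl ?size_polyDl // (monicP mE) eqxx.
Qed.

Lemma mulX_inv_X : 'X * inv_X = 1 + M.
Proof. by rewrite /inv_X /inv_modulus; ring. Qed.

(** Modulo [M], [X - w/X = (X^2 - w)/X], and [X^2 - w] has inverse [X^(N+1)]. *)
Lemma subX_inv_X : ('X - w%:P * inv_X) * 'X^(N.+2) = 1 + (1 - w%:P * 'X^(N.+1)) * M.
Proof. by rewrite /inv_X /inv_modulus !exprS; ring. Qed.

End InvertingModulus.

Section HyperbolaTwistInjectivity.

Variables (p : nat) (K : comNzRingType) (hK : p \in [pchar K]) (u : K) (i : nat).

Local Notation t b := (tens hK i b 1).

(** Evaluate [x], [y], [z] at [X], [w/X], [X^(N+2)] modulo [inv_modulus], with [N = size P] so that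
    [P] is smaller than the modulus. *)
Lemma twist_x_inj P : horner_alg (t (Ax u)) P = 0 -> P = 0.
Proof.
have [mM sM] := inv_modulus_monic (u ^+ (p ^ i)) (size P).
apply: (@twist_horner_inj p K hK u i
  'X ((u ^+ (p ^ i))%:P * inv_X (u ^+ (p ^ i)) (size P)) 'X^((size P).+2) _ mM _ _ (px K)).
- by exists (u ^+ (p ^ i))%:P; rewrite mulrCA mulX_inv_X mulrDr mulr1.
- by rewrite subX_inv_X; eexists.
- by rewrite sM ltnS -addn3 leq_addr.
- by rewrite (@twist_ev_var _ _ _ _ _ _ _ _ 0%N).
Qed.

(** The same evaluation with [x] and [y] exchanged, which changes the sign of [z]. *)
Lemma twist_y_inj P : horner_alg (t (Ay u)) P = 0 -> P = 0.
Proof.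
have [mM sM] := inv_modulus_monic (u ^+ (p ^ i)) (size P).
apply: (@twist_horner_inj p K hK u i
  ((u ^+ (p ^ i))%:P * inv_X (u ^+ (p ^ i)) (size P)) 'X (- 'X^((size P).+2)) _ mM _ _ (py K)).
- by exists (u ^+ (p ^ i))%:P; rewrite mulrC mulrCA mulX_inv_X mulrDr mulr1.
- by rewrite mulrN -mulNr opprB subX_inv_X; eexists.
- by rewrite sM ltnS -addn3 leq_addr.
- by rewrite (@twist_ev_var _ _ _ _ _ _ _ _ 1%N).
Qed.

End HyperbolaTwistInjectivity.

(** * The preperfection of A *)

(** Writing 1 as [(x - y) z] gives [W - 1 = 2 y z] and [W + 1 = 2 x z]. So [W] is a square root of 1
    up to multiples of [xy], with value 1 or -1 after multiplication by [x] or [y]. *)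
Lemma hyperbola_identities (S : comNzRingType) (x y z : S) :
  (x - y) * z = 1 ->
  let W := (x + y) * z in
  [/\ x * (W - 1) = x * y * (z + z), y * (W + 1) = x * y * (z + z) &
      W ^+ 2 - 1 = x * y * (4%:R * z ^+ 2)].
Proof.
move=> xyz W; split.
- have -> : x * (W - 1) = x * (W - (x - y) * z) by rewrite xyz.
  by rewrite /W; ring.
- have -> : y * (W + 1) = y * (W + (x - y) * z) by rewrite xyz.
  by rewrite /W; ring.
- have -> : W ^+ 2 - 1 = W ^+ 2 - ((x - y) * z) ^+ 2 by rewrite xyz expr1n.
  by rewrite /W; ring.
Qed.

Lemma lin_sub_const (K : comNzRingType) (B : comAlgType K) (a b v : K) (s : B) :
  a%:A + b *: (v *: s) - (a + b * v)%:A = b *: (v *: s - v%:A).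
Proof. by rewrite scalerBr [b *: v%:A]scalerA scalerDl opprD addrACA subrr add0r. Qed.

Section HyperbolaRelations.

Variables (K : comNzRingType) (B : comAlgType K) (w : K) (x y z : B).
Hypotheses (xy : x * y = w%:A) (xyz : (x - y) * z = 1).

(** Powers of [x] and [y] generate the unit ideal because [x - y] is a unit; the induction reduces
    to [x s = y s = 0]. *)
Lemma torsion_xy_eq0 k l s : x ^+ k * s = 0 -> y ^+ l * s = 0 -> s = 0.
Proof.
elim: k l s => [l s|k IHk]; first by rewrite mul1r.
elim=> [s _|l IHl s xs ys]; first by rewrite mul1r.
have x0 : x * s = 0.
  by apply: (IHk l.+1); rewrite ?mulrA -?exprSr // mulrAC ys mul0r.
have y0 : y * s = 0.
  by apply: IHl; rewrite ?mulrA -?exprSr // mulrAC xs mul0r.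
by rewrite -[s]mul1r -xyz mulrAC mulrBl x0 y0 subrr mul0r.
Qed.

Variable v : K.
Hypothesis vw : v * w = 0.

Let W := (x + y) * z.

Lemma scale_vxy s : v *: (x * y * s) = 0.
Proof. by rewrite xy mulr_algl scalerA vw scale0r. Qed.

Lemma mulx_sub_sqrt1 : x * (v *: W - v%:A) = 0.
Proof.
have [e _ _] := hyperbola_identities xyz.
by rewrite -scalerBr -scalerAr [x * _]e scale_vxy.
Qed.

Lemma muly_add_sqrt1 : y * (v *: W + v%:A) = 0.
Proof.
have [_ e _] := hyperbola_identities xyz.
by rewrite -scalerDr -scalerAr [y * _]e scale_vxy.
Qed.

Lemma scale_sqrt1_sqr : v *: W ^+ 2 = v%:A.
Proof.
have [_ _ e] := hyperbola_identities xyz.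
by apply/eqP; rewrite -subr_eq0 -scalerBr [_ - 1]e scale_vxy.
Qed.

(** From [v W^2 = v]. With [n = p] this makes [v W] compatible with the relative Frobenius maps. *)
Lemma scale_sqrt1_odd n : odd n -> v *: W ^+ n = v *: W.
Proof.
move=> nodd; rewrite -(odd_double_half n) nodd add1n -mul2n exprS exprM.
suff e : v *: (W ^+ 2) ^+ n./2 = v%:A by rewrite scalerAr e -scalerAr mulr1.
elim: n./2 => [|m IH]; first by rewrite expr0.
by rewrite exprS scalerAr IH -scalerAr mulr1 scale_sqrt1_sqr.
Qed.

End HyperbolaRelations.

Section HyperbolaPreperfection.

Variables (p : nat) (p_odd : odd p) (p_gt1 : (1 < p)%N).
Variables (K : comNzRingType) (hK : p \in [pchar K]) (u v : K).
Hypothesis uv : u * v = 0.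
Hypothesis ann_u : forall k r, u ^+ k * r = 0 -> exists s, r = v * s.
Hypothesis ann_v : forall r, v * r = 0 -> exists s, r = u * s.
Hypothesis half : exists h : K, h + h = 1.

Local Notation A := (Axy u).
Local Notation P := (preperf hK A).
Local Notation B i := (ftwist hK i A).
Local Notation x i := (tens hK i (Ax u) 1).
Local Notation y i := (tens hK i (Ay u) 1).
Local Notation z i := (tens hK i (Axy_inv u) 1).
Local Notation W i := ((x i + y i) * z i).

Lemma v_upow i : v * u ^+ (p ^ i) = 0.
Proof.
have : (0 < p ^ i)%N by rewrite expn_gt0 ltnW.
by case: (p ^ i)%N => // n _; rewrite exprS mulrA (mulrC v) uv mul0r.
Qed.

Lemma x_gen i s : poly_fraction (x i) s.
Proof.
have xy := twist_xy hK u i; have xyz := twist_xyz hK u i.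
elim/twist_ind: s => *; [exact: poly_fraction_alg|exact: poly_fractionD|
  exact: poly_fractionM|exact: poly_fraction_var|exact: poly_fraction_other xy|
  exact: poly_fraction_inv xy xyz].
Qed.

Lemma y_gen i s : poly_fraction (y i) s.
Proof.
have yx : y i * x i = (u ^+ (p ^ i))%:A by rewrite mulrC twist_xy.
have yxz : (y i - x i) * - z i = 1 by rewrite mulrN -mulNr opprB twist_xyz.
have nz : poly_fraction (y i) (- z i) := poly_fraction_inv yx yxz.
elim/twist_ind: s => *; [exact: poly_fraction_alg|exact: poly_fractionD|
  exact: poly_fractionM|exact: poly_fraction_other yx|exact: poly_fraction_var|].
by rewrite -[z i]opprK -scaleN1r; apply: poly_fractionZ.
Qed.

Lemma relfrob1 (C : comAlgType K) i (b : C) :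
  relfrob (tens hK i.+1 b 1) = tens hK i b 1 ^+ p.
Proof. by rewrite relfrobE tens1X. Qed.

(** [c] is the common value of all the [s i] after inverting [x]; the exponent may vary with the
    level. *)
Definition xlim (s : P) c := forall i, exists k, x i ^+ k * (s i - c%:A) = 0.
Definition ylim (s : P) c := forall i, exists k, y i ^+ k * (s i - c%:A) = 0.

Lemma xlim_ex s : exists c, xlim s c.
Proof.
apply: (@constant_up_to_torsion p p_gt1 K (fun i => B i) (fun i => @relfrob p K hK i A)
  (fun i => x i)) => [i|i Q|i t|i].
- exact: relfrob1.
- exact: twist_x_inj.
- exact: x_gen.
- exact: pp_valP.
Qed.

Lemma ylim_ex s : exists c, ylim s c.
Proof.
apply: (@constant_up_to_torsion p p_gt1 K (fun i => B i) (fun i => @relfrob p K hK i A)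
  (fun i => y i)) => [i|i Q|i t|i].
- exact: relfrob1.
- exact: twist_y_inj.
- exact: y_gen.
- exact: pp_valP.
Qed.

Lemma twist_x_torsion i k c : x i ^+ k * c%:A = 0 -> c = 0.
Proof.
exact: (@torsion_const K (fun i => B i) (fun i => x i)
  (fun i P => @twist_x_inj p K hK u i P)).
Qed.

Lemma twist_y_torsion i k c : y i ^+ k * c%:A = 0 -> c = 0.
Proof.
exact: (@torsion_const K (fun i => B i) (fun i => y i)
  (fun i P => @twist_y_inj p K hK u i P)).
Qed.

Lemma lim_inj s s' c d : xlim s c -> ylim s d -> xlim s' c -> ylim s' d -> s = s'.
Proof.
move=> xs ys xs' ys'; apply: preperf_eq => i; apply/eqP; rewrite -subr_eq0; apply/eqP.
have [k ek] := xs i; have [k' ek'] := xs' i.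
have [l el] := ys i; have [l' el'] := ys' i.
have sub a : s i - s' i = (s i - a%:A) - (s' i - a%:A) by rewrite opprB addrA subrK.
apply: (torsion_xy_eq0 (twist_xyz hK u i) (k := k + k') (l := l + l')).
  by rewrite (sub c) exprD mulrBr mulrAC ek mul0r -mulrA ek' mulr0 subrr.
by rewrite (sub d) exprD mulrBr mulrAC el mul0r -mulrA el' mulr0 subrr.
Qed.

Lemma xlim0 c : xlim 0 c -> c = 0.
Proof.
move=> /(_ 0%N) [k]; rewrite sub0r mulrN => /eqP; rewrite oppr_eq0 => /eqP.
exact: twist_x_torsion.
Qed.

Lemma ylim0 c : ylim 0 c -> c = 0.
Proof.
move=> /(_ 0%N) [k]; rewrite sub0r mulrN => /eqP; rewrite oppr_eq0 => /eqP.
exact: twist_y_torsion.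
Qed.

(** At level 0 a power of [u = xy] contains enough factors [x] and [y] to kill both [s - c] and
    [s - d]. *)
Lemma xlim_ylim_torsion s c d : xlim s c -> ylim s d -> exists k, u ^+ k * (c - d) = 0.
Proof.
move=> /(_ 0%N) [k ek] /(_ 0%N) [l el].
(* With exponent 0 this says that scalars embed in the twist, so the identity may be checked
   there. *)
exists (k + l)%N; apply: (@twist_x_torsion 0%N 0%N).
rewrite expr0 mul1r -scalerA -mulr_algl.
have -> : (u ^+ (k + l))%:A = x 0 ^+ l * x 0 ^+ k * (y 0 ^+ k * y 0 ^+ l) :> B 0.
  by rewrite -!exprD [(l + k)%N]addnC -exprMn twist_xy expn0 expr1 exprZn expr1n.
have -> : (c - d)%:A = (s 0%N - d%:A) - (s 0%N - c%:A) :> B 0.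
  by rewrite scalerBl opprB [RHS]addrC addrA subrK.
rewrite mulrBr -[X in X - _]mulrA -[X in _ * X - _]mulrA el !mulr0 sub0r.
by rewrite mulrAC -[X in X * _]mulrA ek mulr0 mul0r oppr0.
Qed.

(** The relative Frobenius raises [W] to the power [p], by additivity of [p]-th powers, and
    [v W^p = v W] for odd [p]. *)
Fact pp_alphaP i : relfrob (v *: W i.+1) = v *: W i.
Proof.
rewrite linearZ rmorphM rmorphD /= !relfrob1.
rewrite -(scale_sqrt1_odd (twist_xy hK u i) (twist_xyz hK u i) (v_upow i) p_odd).
rewrite exprMn; congr (v *: (_ * _)).
rewrite -(pFrobenius_autE (pchar_alg hK _)) -pFrobenius_autD_comm ?pFrobenius_autE //.
exact: mulrC.
Qed.

Definition pp_alpha : P := Preperf pp_alphaP.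

Lemma xlim_lin a b : xlim (a%:A + b *: pp_alpha) (a + b * v).
Proof.
move=> i; exists 1%N; rewrite expr1.
have -> : (a%:A + b *: pp_alpha : P) i - (a + b * v)%:A = b *: (v *: W i - v%:A).
  exact: lin_sub_const.
rewrite -scalerAr (mulx_sub_sqrt1 (twist_xy hK u i) (twist_xyz hK u i) (v_upow i)).
exact: scaler0.
Qed.

Lemma ylim_lin a b : ylim (a%:A + b *: pp_alpha) (a - b * v).
Proof.
move=> i; exists 1%N; rewrite expr1.
have -> : (a%:A + b *: pp_alpha : P) i - (a - b * v)%:A = b *: (v *: W i + v%:A).
  by have := lin_sub_const a b (- v) (- W i); rewrite !scaleNr !scalerN !opprK mulrN.
rewrite -scalerAr (muly_add_sqrt1 (twist_xy hK u i) (twist_xyz hK u i) (v_upow i)).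
exact: scaler0.
Qed.

Lemma pp_alpha_span s : exists a b, s = a%:A + b *: pp_alpha.
Proof.
have [c xs] := xlim_ex s; have [d ys] := ylim_ex s.
have [k /ann_u [b ecd]] := xlim_ylim_torsion xs ys.
have [h eh] := half.
have ed : d = c - v * b by rewrite -ecd opprB addrC subrK.
(* Solves [c = a + b' v], [d = a - b' v], given [c - d = v b]; elements with equal limits
   coincide. *)
pose a := h * (c + d); pose b' := h * b; exists a, b'.
have ec' : c = a + b' * v by rewrite /a /b' ed -[LHS]mul1r -eh; ring.
have ed' : d = a - b' * v by rewrite /a /b' ed -[LHS]mul1r -eh; ring.
apply: lim_inj xs ys _ _; first by rewrite [X in xlim _ X]ec'; apply: xlim_lin.
by rewrite [X in ylim _ X]ed'; apply: ylim_lin.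
Qed.

(** Both limits [a + b v] and [a - b v] vanish; halving their sum kills [a], and then [b v = 0]. *)
Lemma pp_alpha_free a b : a%:A + b *: pp_alpha = 0 -> a = 0 /\ exists s, b = u * s.
Proof.
move=> e; have := xlim_lin a b; have := ylim_lin a b; rewrite e => /ylim0 ed /xlim0 ec.
have [h eh] := half.
have a0 : a = 0.
  have -> : a = h * ((a + b * v) + (a - b * v)) by rewrite -[LHS]mul1r -eh; ring.
  by rewrite ec ed addr0 mulr0.
by split=> //; apply: ann_v; rewrite mulrC -ec a0 add0r.
Qed.

Lemma pp_alpha_u : u *: pp_alpha = 0.
Proof. by apply: preperf_eq => i /=; rewrite scalerA uv scale0r. Qed.

Lemma pp_alpha_sqr : pp_alpha ^+ 2 = (v ^+ 2)%:A.
Proof.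
apply: preperf_eq => i /=; rewrite -[LHS]/((v *: W i) ^+ 2) exprZn expr2 -scalerA.
rewrite (scale_sqrt1_sqr (twist_xy hK u i) (twist_xyz hK u i) (v_upow i)).
by rewrite scalerA -expr2.
Qed.

Lemma pp_alpha_proj : pp_proj pp_alpha = v *: ((Ax u + Ay u) * Axy_inv u).
Proof.
rewrite /pp_proj /= linearZ /= rmorphM rmorphD /=.
by rewrite !ftwist0_toE !scale1r.
Qed.

End HyperbolaPreperfection.

(** * Twists of an algebra spanned by 1 and alpha *)

Lemma inj_surj_bijective (S T : Type) (f : S -> T) :
  injective f -> (forall y, exists x, f x = y) -> bijective f.
Proof.
move=> finj /choice[g fg]; exists g => // x; exact/finj/fg.
Qed.

Section PrincipalSubgroup.

Variables (K : comNzRingType) (c : K).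

(** The principal ideal, kept only as a subgroup so that the quotient group exists even when [c] is
    a unit. *)
Definition multiple : {pred K} := fun x => `[< exists s, x = c * s >].

Lemma multipleP x : reflect (exists s, x = c * s) (x \in multiple).
Proof. exact: asboolP. Qed.

Fact multiple_zmod_closed : zmod_closed multiple.
Proof.
split=> [|x y /multipleP[s ->] /multipleP[t ->]]; apply/multipleP.
  by exists 0; rewrite mulr0.
by exists (s - t); rewrite mulrBr.
Qed.

HB.instance Definition _ := GRing.isZmodClosed.Build K multiple multiple_zmod_closed.

End PrincipalSubgroup.

Section TwistOfRankTwo.

Local Open Scope quotient_scope.

Variables (p : nat) (p_odd : odd p) (p_gt1 : (1 < p)%N).
Variables (K : comNzRingType) (hK : p \in [pchar K]) (u v : K).
Variables (B : comAlgType K) (al : B).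
Hypothesis al_span : forall s, exists a b, s = a%:A + b *: al.
Hypothesis al_free : forall a b, a%:A + b *: al = 0 -> a = 0 /\ exists s, b = u * s.
Hypothesis al_u : u *: al = 0.
Hypothesis al_sqr : al ^+ 2 = (v ^+ 2)%:A.

Local Notation t i := (tens hK i al 1).

Lemma al_eq a b a' b' : a%:A + b *: al = a'%:A + b' *: al ->
  a = a' /\ exists s, b = b' + u * s.
Proof.
move=> /eqP; rewrite -subr_eq0 opprD addrACA -!scalerBl => /eqP /al_free[e [s es]].
split; first by apply/eqP; rewrite -subr_eq0 e.
by exists s; rewrite -es addrC subrK.
Qed.

Lemma twist_span i (s : ftwist hK i B) : exists a b, s = a%:A + b *: t i.
Proof.
elim/ftwist_ind: s => [|X Y [a [b ->]] [a' [b' ->]]|s r].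
- by exists 0, 0; rewrite !scale0r addr0.
- by exists (a + a'), (b + b'); rewrite !scalerDl addrACA.
have [a [b ->]] := al_span s; exists (r * a ^+ (p ^ i)), (r * b ^+ (p ^ i)).
by rewrite tensE tensDl tens1_alg tens1Z scalerDr !scalerA.
Qed.

(** As a module [B] is the sum of [K] and [K/u], so the twist should be the sum of [K] and [K/u^q];
    its two projections are lifted from chosen coordinates [f]. *)
Lemma twist_free i a b : a%:A + b *: t i = 0 :> ftwist hK i B ->
  a = 0 /\ exists s, b = u ^+ (p ^ i) * s.
Proof.
have /choice[f fE] : forall s, exists ab : K * K, s = ab.1%:A + ab.2 *: al.
  by move=> s; have [x [y ->]] := al_span s; exists (x, y).
have fD s s' : (f (s + s')).1 = (f s).1 + (f s').1 /\
    exists e, (f (s + s')).2 = (f s).2 + (f s').2 + u * e.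
  by apply: al_eq; rewrite -fE {1}(fE s) {1}(fE s') !scalerDl addrACA.
have fZ k s : (f (k *: s)).1 = k * (f s).1 /\
    exists e, (f (k *: s)).2 = k * (f s).2 + u * e.
  by apply: al_eq; rewrite -fE {1}(fE s) scalerDr !scalerA.
have f1 : (f 1).1 = 1 /\ exists e, (f 1).2 = 0 + u * e.
  by apply: al_eq; rewrite -fE scale0r addr0 scale1r.
have fal : (f al).1 = 0 /\ exists e, (f al).2 = 1 + u * e.
  by apply: al_eq; rewrite -fE scale0r add0r scale1r.
(* The second coordinate is linear only modulo [u]; Frobenius moves this ambiguity into multiples of
   [u^q], which vanish in [V]. *)
pose V := {ideal_quot (multiple (u ^+ (p ^ i)))}.
have piM e r : \pi_V (frobn hK i (u * e) * r) = 0 :> V.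
  rewrite -[0](raddf0 \pi_V); apply/eqP; rewrite -Quotient.idealrBE subr0.
  by apply/multipleP; exists (e ^+ (p ^ i) * r); rewrite frobnE exprMn mulrA.
have pi0P r : \pi_V r = 0 :> V -> exists s, r = u ^+ (p ^ i) * s.
  rewrite -[0](raddf0 \pi_V) => /eqP; rewrite -Quotient.idealrBE subr0.
  by move=> /multipleP.
pose g0 (s : B) r := frobn hK i (f s).1 * r.
pose g1 (s : B) r : V := \pi_V (frobn hK i (f s).2 * r).
have c0 : tens_compatible hK i g0.
  split=> [s s' r|s r r'|k s r]; rewrite /g0.
  - by rewrite (fD s s').1 rmorphD mulrDl.
  - by rewrite mulrDr.
  - by rewrite (fZ k s).1 rmorphM mulrA [_ * frobn _ _ k]mulrC.
have c1 : tens_compatible hK i g1.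
  split=> [s s' r|s r r'|k s r]; rewrite /g1.
  - have [e ->] := (fD s s').2.
    by rewrite !rmorphD !mulrDl !raddfD /= piM addr0.
  - by rewrite mulrDr raddfD.
  - have [e ->] := (fZ k s).2.
    by rewrite rmorphD mulrDl raddfD /= piM addr0 rmorphM mulrA [_ * frobn _ _ k]mulrC.
rewrite ftwist_algE -tensE => eab; split.
  have := congr1 (tens_lift g0) eab.
  rewrite tens_liftD // !tens_liftE // tens_lift0 //.
  by rewrite /g0 f1.1 fal.1 rmorph1 rmorph0 mul1r mul0r addr0.
have := congr1 (tens_lift g1) eab.
rewrite tens_liftD // !tens_liftE // tens_lift0 // /g1.
have [e ->] := f1.2; have [e' ->] := fal.2.
rewrite add0r piM add0r rmorphD mulrDl raddfD /= piM addr0 rmorph1 mul1r.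
exact: pi0P.
Qed.

Lemma twist_al_u i : u ^+ (p ^ i) *: t i = 0.
Proof.
by rewrite -tens1Z al_u; apply: (addrI (tens hK i 0 1)); rewrite -tensDl !addr0.
Qed.

Lemma twist_al_sqr i : t i ^+ 2 = (v ^+ (2 * p ^ i))%:A.
Proof. by rewrite -tens1X al_sqr tens1_alg -exprM. Qed.

(** [t^p = (t^2)^((p-1)/2) t = v^(q(p-1)) t] with [q = p^i], and the exponent of [v] is positive, so
    one factor [v] splits off. *)
Lemma twist_al_expp i : exists r, t i ^+ p = (r * v) *: t i.
Proof.
have m0 : (0 < p./2)%N by rewrite half_gt0.
exists (v ^+ (2 * p ^ i * p./2).-1); rewrite -exprSr prednK; last first.
  by rewrite !muln_gt0 m0 expn_gt0 (ltnW p_gt1).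
have pE : p = (2 * p./2).+1 by rewrite -[LHS](odd_double_half p) p_odd add1n mul2n.
transitivity (t i ^+ (2 * p./2).+1); first by congr (_ ^+ _).
rewrite exprSr exprM twist_al_sqr.
by rewrite exprZn expr1n -exprM mulr_algl.
Qed.

Hypothesis Krull : forall q b,
  (forall n, exists r s, b = r * v ^+ n + u ^+ q * s) -> exists s, b = u ^+ q * s.

(** Each step down the tower puts one more factor [v] in front of [t], so [n] steps are taken from
    level [i + n]. *)
Lemma pp_val_expand (s : preperf hK B) n i :
  exists a b, s i = a%:A + (b * v ^+ n) *: t i.
Proof.
elim: n i => [|n IH] i.
  by have [a [b ->]] := twist_span (s i); exists a, b; rewrite mulr1.
have [a [b e]] := IH i.+1; have [r er] := twist_al_expp i.
exists a, (b * r); rewrite -pp_valP e rmorphD /= !linearZ rmorph1 /=.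
rewrite relfrobE tens1X er scalerA; congr (_ + _ *: _).
by rewrite exprSr; ring.
Qed.

(** The coefficient [b] of [t] is unique modulo [u^q], hence a multiple of every [v^n] there; by
    [Krull] it lies in [(u^q)], which annihilates [t]. *)
Lemma pp_val_const (s : preperf hK B) i : exists a, s i = a%:A.
Proof.
have [a [b e]] := pp_val_expand s 0 i; exists a; rewrite mulr1 in e.
have [c ec] : exists c, b = u ^+ (p ^ i) * c.
  apply: Krull => n; have [a' [b' e']] := pp_val_expand s n i.
  have /twist_free[_ [c ec]] : (a - a')%:A + (b - b' * v ^+ n) *: t i = 0.
    by rewrite !scalerBl addrACA -opprD -e -e' subrr.
  by exists b', c; rewrite -ec addrC subrK.
by rewrite e ec mulrC -scalerA twist_al_u scaler0 addr0.
Qed.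

Lemma twist_alg_inj i : injective (fun a : K => a%:A : ftwist hK i B).
Proof.
move=> a b /eqP; rewrite -subr_eq0 -scalerBl => /eqP e.
have [|ab _] := @twist_free i (a - b) 0; first by rewrite scale0r addr0.
by apply/eqP; rewrite -subr_eq0 ab.
Qed.

(** Every level is a scalar; the scalars agree because the transition maps fix scalars and scalars
    embed in each twist. *)
Lemma preperf_alg_bijective : bijective (in_alg (preperf hK B)).
Proof.
apply: inj_surj_bijective => [a b ab|s].
  by apply: (@twist_alg_inj 0%N); apply: (congr1 (fun s : preperf hK B => s 0%N) ab).
have [a ea] := pp_val_const s 0; exists a; apply: preperf_eq => i.
elim: i => [|i IH]; first by rewrite ea.
have [b eb] := pp_val_const s i.+1; rewrite eb.
suff -> : b = a by [].
apply: (@twist_alg_inj i); rewrite /= -[RHS]/((a%:A : preperf hK B) i) IH -pp_valP eb.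
by rewrite linearZ rmorph1.
Qed.

End TwistOfRankTwo.

(** * Inverting a bijective structure map *)

Section AlgebraInverse.

Variables (K : comNzRingType) (T : comAlgType K) (g : T -> K).

(* The unused proofs let the morphism structures below be inferred. *)
Definition alg_inv of cancel (in_alg T) g & cancel g (in_alg T) : T -> K^o := g.

Hypotheses (algK : cancel (in_alg T) g) (gK : cancel g (in_alg T)).

Local Notation inv := (alg_inv algK gK).

Lemma alg_invK x : in_alg T (inv x) = x.
Proof. exact: gK. Qed.

Fact alg_inv_is_zmod : zmod_morphism inv.
Proof.
move=> x y; apply: (can_inj algK); rewrite (rmorphB (in_alg T)).
by rewrite [LHS]alg_invK; congr (_ - _); rewrite [RHS]alg_invK.
Qed.
Fact alg_inv_is_monoid : monoid_morphism inv.
Proof.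
split=> [|x y]; apply: (can_inj algK).
  by rewrite [LHS]alg_invK (rmorph1 (in_alg T)).
rewrite (rmorphM (in_alg T)).
by rewrite [LHS]alg_invK; congr (_ * _); rewrite [RHS]alg_invK.
Qed.
Fact alg_inv_is_scalable : scalable inv.
Proof.
move=> a x; apply: (can_inj algK); rewrite (rmorphM (in_alg T)) [LHS]alg_invK.
by rewrite -mulr_algl; congr (_ * _); rewrite [RHS]alg_invK.
Qed.

HB.instance Definition _ := GRing.isZmodMorphism.Build T K^o inv alg_inv_is_zmod.
HB.instance Definition _ := GRing.isMonoidMorphism.Build T K^o inv alg_inv_is_monoid.
HB.instance Definition _ := GRing.isScalable.Build K T K^o *:%R inv alg_inv_is_scalable.

End AlgebraInverse.

Lemma alg_bijective_iso (K : comNzRingType) (T : comAlgType K) :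
  bijective (in_alg T) -> exists psi : {lrmorphism T -> K^o}, bijective psi.
Proof.
case=> g algK gK; exists (alg_inv algK gK); exists (in_alg T).
  exact: gK.
exact: algK.
Qed.

(** * The algebra R[alpha]/(u alpha, v^2 - alpha^2) and the base ring *)

Section HornerMorphism.

Variables (K : comNzRingType) (T : comAlgType K) (x : T).

(* [horner_alg x] is only declared as linear for the scaling [a, y |-> a%:A * y]. *)
Definition eval_at (f : {poly K}) : T := horner_alg x f.

Fact eval_at_is_zmod : zmod_morphism eval_at.
Proof. exact: rmorphB. Qed.
Fact eval_at_is_monoid : monoid_morphism eval_at.
Proof. by split=> [|f g]; rewrite /eval_at ?rmorph1 ?rmorphM. Qed.
Fact eval_at_is_scalable : scalable eval_at.
Proof. by move=> a f; rewrite /eval_at linearZ /= mulr_algl. Qed.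

HB.instance Definition _ := GRing.isZmodMorphism.Build {poly K} T eval_at eval_at_is_zmod.
HB.instance Definition _ :=
  GRing.isMonoidMorphism.Build {poly K} T eval_at eval_at_is_monoid.
HB.instance Definition _ :=
  GRing.isScalable.Build K {poly K} T *:%R eval_at eval_at_is_scalable.

End HornerMorphism.

Section RankTwoAlgebra.

Variables (K : comNzRingType) (u v : K) (huv : u * v = 0).

Definition Calpha_pi : {poly K} -> Calpha huv := @quot_map K {poly K} (C_ideal huv).

HB.instance Definition _ :=
  GRing.LRMorphism.copy Calpha_pi (@quot_map K {poly K} (C_ideal huv)).

Lemma alpha_u : u *: alpha huv = 0.
Proof.
have -> : u *: alpha huv = Calpha_pi (u%:P * 'X) by rewrite mul_polyC linearZ.
have -> : 0 = Calpha_pi 0 by rewrite raddf0.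
apply/quot_map_eq; rewrite subr0; apply/gen_ideal2P; exists 1, 0.
by rewrite mul1r mul0r addr0.
Qed.

Lemma alpha_sqr : alpha huv ^+ 2 = (v ^+ 2)%:A.
Proof.
have -> : alpha huv ^+ 2 = Calpha_pi 'X^2 by rewrite rmorphXn.
have -> : (v ^+ 2)%:A = Calpha_pi (v ^+ 2)%:P by rewrite -alg_polyC linearZ rmorph1.
apply/quot_map_eq/gen_ideal2P; exists 0, (-1).
by rewrite mul0r add0r mulN1r opprB.
Qed.

Lemma alpha_span (x : Calpha huv) : exists a b, x = a%:A + b *: alpha huv.
Proof.
rewrite -[x]quot_map_repr -/(Calpha_pi (repr x)).
elim/poly_ind: (repr x) => [|f c [a [b IH]]].
  by exists 0, 0; rewrite !scale0r addr0 raddf0.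
exists (c + b * v ^+ 2), a; rewrite rmorphD rmorphM /= IH.
have -> : Calpha_pi c%:P = c%:A by rewrite -alg_polyC linearZ rmorph1.
rewrite -/(alpha huv) mulrDl -!scalerAl mul1r -expr2 alpha_sqr scalerA scalerDl.
by rewrite -addrA addrC [c%:A + _]addrC.
Qed.

Variables (T : comAlgType K) (al : T).
Hypothesis al_u : u *: al = 0.
Hypothesis al_sqr : al ^+ 2 = (v ^+ 2)%:A.

Fact eval_at_C_ideal : {in C_ideal huv, forall f, eval_at al f = 0}.
Proof.
have e1 : eval_at al (u%:P * 'X) = 0.
  by rewrite mul_polyC linearZ /= /eval_at horner_algX.
have e2 : eval_at al ((v ^+ 2)%:P - 'X^2) = 0.
  by rewrite /eval_at rmorphB /= horner_algC rmorphXn /= horner_algX al_sqr subrr.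
move=> f /gen_ideal2P[c [d ->]]; rewrite rmorphD [X in X + _]rmorphM.
by rewrite [X in _ + X]rmorphM /= e1 e2 !mulr0 addr0.
Qed.

Definition Calpha_map : {lrmorphism Calpha huv -> T} := quot_lift eval_at_C_ideal.

Lemma Calpha_map_alpha : Calpha_map (alpha huv) = al.
Proof. by rewrite [LHS]quot_liftE /= /eval_at horner_algX. Qed.

Hypothesis al_span : forall s, exists a b, s = a%:A + b *: al.
Hypothesis al_free : forall a b, a%:A + b *: al = 0 -> a = 0 /\ exists s, b = u * s.

(** A kernel element [a + b alpha] has [a = 0] and [b] in [(u)], so it vanishes already in the
    source by [u alpha = 0]. *)
Lemma Calpha_map_bijective : bijective Calpha_map.
Proof.
have E a b : Calpha_map (a%:A + b *: alpha huv) = a%:A + b *: al.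
  by rewrite linearD linearZ [X in _ + X]linearZ rmorph1 -[in RHS]Calpha_map_alpha.
apply: inj_surj_bijective => [x y /eqP|s].
  rewrite -subr_eq0 -rmorphB => /eqP; have [a [b e]] := alpha_span (x - y).
  rewrite e [LHS]E => /al_free[a0 [s bs]]; apply/eqP; rewrite -subr_eq0 e a0 bs.
  by rewrite mulrC -scalerA alpha_u scaler0 scale0r addr0.
by have [a [b ->]] := al_span s; exists (a%:A + b *: alpha huv); apply: E.
Qed.

End RankTwoAlgebra.

(** * Coefficients of power series and divisibility in the base ring *)

Section PowerSeriesCoefficients.

Variable k : comNzRingType.

Local Notation u := (fps2_u k).
Local Notation v := (fps2_v k).

Lemma fps2_coefD (f g : fps2 k) m n :
  fps2_coef (f + g) m n = fps2_coef f m n + fps2_coef g m n.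
Proof. by []. Qed.

Lemma fps2_coef_uM f m n :
  fps2_coef (u * f) m n = if m is m'.+1 then fps2_coef f m' n else 0.
Proof.
have e : fps2_coef (u * f) m n = \sum_(i < m.+1) \sum_(j < n.+1)
    ((i == 1%N :> nat) && (j == 0%N :> nat))%:R * fps2_coef f (m - i) (n - j) by [].
rewrite e; case: m {e} => [|m].
  by rewrite big_ord1 big1 // => j _; rewrite mul0r.
rewrite big_ord_recl big1 ?add0r => [|j _]; last by rewrite mul0r.
rewrite big_ord_recl [X in _ + X]big1 ?addr0 => [|i _]; last first.
  by rewrite big1 // => j _; rewrite mul0r.
rewrite big_ord_recl [X in _ + X]big1 ?addr0 => [|j _]; last by rewrite mul0r.
by rewrite mul1r subn0 /= subSS subn0.
Qed.

Lemma fps2_coef_vM f m n :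
  fps2_coef (v * f) m n = if n is n'.+1 then fps2_coef f m n' else 0.
Proof.
have e : fps2_coef (v * f) m n = \sum_(i < m.+1) \sum_(j < n.+1)
    ((i == 0%N :> nat) && (j == 1%N :> nat))%:R * fps2_coef f (m - i) (n - j) by [].
rewrite e big_ord_recl [X in _ + X]big1 ?addr0 => [|i _]; last first.
  by rewrite big1 // => j _; rewrite mul0r.
case: n {e} => [|n]; first by rewrite big_ord1 mul0r.
rewrite big_ord_recl mul0r add0r.
rewrite big_ord_recl [X in _ + X]big1 ?addr0 => [|j _]; last by rewrite mul0r.
by rewrite mul1r subn0 /= subSS subn0.
Qed.

Lemma fps2_coef_uXM q f m n :
  fps2_coef (u ^+ q * f) m n = if (m < q)%N then 0 else fps2_coef f (m - q) n.
Proof.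
elim: q m => [|q IH] m; first by rewrite expr0 mul1r subn0.
by rewrite exprS -mulrA fps2_coef_uM; case: m => [|m] //; rewrite IH ltnS subSS.
Qed.

Lemma fps2_coef_vXM q f m n :
  fps2_coef (v ^+ q * f) m n = if (n < q)%N then 0 else fps2_coef f m (n - q).
Proof.
elim: q n => [|q IH] n; first by rewrite expr0 mul1r subn0.
by rewrite exprS -mulrA fps2_coef_vM; case: n => [|n] //; rewrite IH ltnS subSS.
Qed.

(** Hence the coefficients on the two axes depend only on the class modulo [uv]. *)
Lemma fps2_coef_uvM f m :
  fps2_coef (f * (u * v)) m 0 = 0 /\ fps2_coef (f * (u * v)) 0 m = 0.
Proof.
have -> : f * (u * v) = u * (v * f) by rewrite mulrC mulrA.
by rewrite !fps2_coef_uM; split=> //; case: m => // m; rewrite fps2_coef_vM.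
Qed.

End PowerSeriesCoefficients.

Section BaseRingFacts.

Local Open Scope quotient_scope.

Variable p : nat.

Local Notation U := (fps2_u 'F_p).
Local Notation V := (fps2_v 'F_p).

Definition Ruv_pi (f : fps2 'F_p) : Ruv p := \pi_{ideal_quot (@uv_ideal p)} f.

Fact Ruv_pi_is_zmod : zmod_morphism Ruv_pi.
Proof. exact: rmorphB. Qed.
Fact Ruv_pi_is_monoid : monoid_morphism Ruv_pi.
Proof. by split=> [|f g]; rewrite /Ruv_pi ?rmorph1 ?rmorphM. Qed.

HB.instance Definition _ :=
  GRing.isZmodMorphism.Build (fps2 'F_p) (Ruv p) Ruv_pi Ruv_pi_is_zmod.
HB.instance Definition _ :=
  GRing.isMonoidMorphism.Build (fps2 'F_p) (Ruv p) Ruv_pi Ruv_pi_is_monoid.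

Lemma Ruv_pi_surj r : exists f, r = Ruv_pi f.
Proof. by exists (repr r); rewrite /Ruv_pi reprK. Qed.

Lemma Ruv_pi_eq f g : Ruv_pi f = Ruv_pi g <-> exists h, f = g + h * (U * V).
Proof.
have -> : Ruv_pi f = Ruv_pi g <-> f - g \in @uv_ideal p.
  by rewrite Quotient.idealrBE; split=> /eqP.
split=> [/gen_idealP[c]|[h ->]].
  by rewrite big_ord1 /= => e; exists (c ord0); rewrite -e addrC subrK.
by apply/gen_idealP; exists (fun=> h); rewrite big_ord1 addrC addKr.
Qed.

(** On the [u]-axis, multiplication by [u^k] shifts coefficients injectively; so [f] has no pure
    powers of [u], constant term included, and is divisible by [v]. *)
Lemma Ruv_ann_u k r : Ru p ^+ k * r = 0 -> exists s, r = Rv p * s.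
Proof.
have [f ->] := Ruv_pi_surj r => e.
have /Ruv_pi_eq[h eh] : Ruv_pi (U ^+ k * f) = Ruv_pi 0.
  by rewrite rmorphM rmorphXn rmorph0.
have f0 m : fps2_coef f m 0 = 0.
  have := congr1 (fun g => fps2_coef g (m + k) 0) eh.
  by rewrite add0r (fps2_coef_uvM _ _).1 fps2_coef_uXM ltnNge leq_addl addnK.
pose g := Fps2 (fun m n => fps2_coef f m n.+1).
exists (Ruv_pi g); have -> : f = V * g; last by rewrite rmorphM.
by apply: fps2P => m [|n]; rewrite fps2_coef_vM.
Qed.

Lemma Ruv_ann_v r : Rv p * r = 0 -> exists s, r = Ru p * s.
Proof.
have [f ->] := Ruv_pi_surj r => e.
have /Ruv_pi_eq[h eh] : Ruv_pi (V * f) = Ruv_pi 0 by rewrite rmorphM rmorph0.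
have f0 n : fps2_coef f 0 n = 0.
  have := congr1 (fun g => fps2_coef g 0 n.+1) eh.
  by rewrite add0r (fps2_coef_uvM _ _).2 fps2_coef_vM.
pose g := Fps2 (fun m n => fps2_coef f m.+1 n).
exists (Ruv_pi g); have -> : f = U * g; last by rewrite rmorphM.
by apply: fps2P => [[|m] n]; rewrite fps2_coef_uM.
Qed.

(** Krull's intersection theorem for [v] in [R/u^q], read off the axes: [n = 1] kills the
    coefficients of [u^m] for [m < q], and large [n] kills those of all powers of [v]. *)
Lemma Ruv_Krull q b :
  (forall n, exists r s, b = r * Rv p ^+ n + Ru p ^+ q * s) ->
  exists s, b = Ru p ^+ q * s.
Proof.
case: q => [_|q]; first by exists b; rewrite mul1r.
have [f ->] := Ruv_pi_surj b => H.
have {}H n : exists r s h, f = V ^+ n * r + U ^+ q.+1 * s + h * (U * V).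
  have [r [s e]] := H n; have [r' er] := Ruv_pi_surj r; have [s' es] := Ruv_pi_surj s.
  exists r', s'; apply/Ruv_pi_eq.
  by rewrite e er es rmorphD !rmorphM !rmorphXn mulrC.
have f0 m : (m < q.+1)%N -> fps2_coef f m 0 = 0.
  move=> mq; have [r [s [h ->]]] := H 1%N.
  by rewrite !fps2_coefD (fps2_coef_uvM _ _).1 fps2_coef_vXM fps2_coef_uXM mq !addr0.
have f1 n : fps2_coef f 0 n = 0.
  have [r [s [h ->]]] := H n.+1.
  by rewrite !fps2_coefD (fps2_coef_uvM _ _).2 fps2_coef_vXM fps2_coef_uXM ltnSn !addr0.
(* [s] collects the surviving part of the [u]-axis, [h] everything off the axes. *)
pose s := Fps2 (fun m n => if n is _.+1 then 0 else fps2_coef f (m + q.+1) 0).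
pose h := Fps2 (fun m n => fps2_coef f m.+1 n.+1).
exists (Ruv_pi s); have -> : Ru p ^+ q.+1 * Ruv_pi s = Ruv_pi (U ^+ q.+1 * s).
  by rewrite rmorphM rmorphXn.
apply/Ruv_pi_eq; exists h; apply: fps2P => m n.
rewrite fps2_coefD [h * _]mulrC -mulrA fps2_coef_uXM fps2_coef_uM.
case: m => [|m]; first by rewrite f1 /= addr0.
rewrite fps2_coef_vM; case: n => [|n] /=; last by rewrite if_same add0r.
by rewrite addr0; case: ltnP => [mq|qm]; [rewrite f0|rewrite subnK].
Qed.

Lemma Ruv_half : prime p -> p != 2%N -> exists h : Ruv p, h + h = 1.
Proof.
move=> hp p2; have podd : odd p by case: (even_prime hp) p2 => [->|].
(* The half is [(p + 1)/2], as [p + 1 = 1] in characteristic [p]. *)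
exists (uphalf p)%:R; rewrite -natrD addnn.
have -> : (uphalf p).*2 = p.+1.
  by rewrite uphalf_half podd doubleD -[in RHS](odd_double_half p) podd.
by rewrite mulrS (pcharf0 (pchar_Ruv hp)) addr0.
Qed.

End BaseRingFacts.

Theorem lemma4p5p2 (p : nat) (hp : prime p) (hp2 : p != 2%N) :
  (exists phi : {lrmorphism Calpha (Ruv_uv p) ->
                   preperf (pchar_Ruv hp) (Axy (Ru p))},
     bijective phi /\
     pp_proj (phi (alpha (Ruv_uv p))) =
       Rv p *: ((Ax (Ru p) + Ay (Ru p)) * Axy_inv (Ru p))) /\
  (exists psi : {lrmorphism
                   preperf (pchar_Ruv hp) (preperf (pchar_Ruv hp) (Axy (Ru p))) ->
                   (Ruv p)^o},
     bijective psi).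
Proof.
have podd : odd p by case: (even_prime hp) hp2 => [->|].
have p1 := prime_gt1 hp.
have half := Ruv_half hp hp2.
have annu := @Ruv_ann_u p; have annv := @Ruv_ann_v p.
pose al := pp_alpha podd p1 (pchar_Ruv hp) (Ruv_uv p).
have span : forall s, exists a b, s = a%:A + b *: al.
  exact: (pp_alpha_span podd p1 (Ruv_uv p) annu half).
have free a b : a%:A + b *: al = 0 -> a = 0 /\ exists s, b = Ru p * s.
  exact: pp_alpha_free annv half _ _.
have alu : Ru p *: al = 0 := pp_alpha_u _ _ _ _.
have alsqr : al ^+ 2 = (Rv p ^+ 2)%:A := pp_alpha_sqr _ _ _ _.
split.
  exists (Calpha_map (Ruv_uv p) alu alsqr); split; first exact: Calpha_map_bijective.
  by rewrite Calpha_map_alpha pp_alpha_proj.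
(* The rank-two result is applied to the first preperfection itself, with [al] as generator. *)
exact: (alg_bijective_iso (@preperf_alg_bijective p podd p1 (Ruv p) (pchar_Ruv hp)
  (Ru p) (Rv p) (preperf (pchar_Ruv hp) (Axy (Ru p))) al span free alu alsqr
  (@Ruv_Krull p))).
Qed.
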